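(* Let $(M^n,g(t))$, $n\ge 3$, be an $n$-dimensional smooth manifold with a time-dependent Riemannian metric evolving by the Ricci flow $\frac{\partial}{\partial t}g_{ij}=-2R_{ij}$. Then the Weyl tensor satisfies the following evolution equation, in local coordinates: $$ \begin{aligned} \Bigl(\frac{\partial}{\partial t}-\Delta\Bigr)W_{ijkl}=\;&2\,(D_{ijkl}-D_{ijlk}+D_{ikjl}-D_{iljk})\\ &-g^{pq}(R_{ip}W_{qjkl}+R_{jp}W_{iqkl}+R_{kp}W_{ijql}+R_{lp}W_{ijkq})\\ &+\frac{2}{(n-2)^2}g^{pq}(R_{ip}R_{qk}g_{jl}-R_{ip}R_{ql}g_{jk}+R_{jp}R_{ql}g_{ik}-R_{jp}R_{qk}g_{il})\\ &-\frac{2R}{(n-2)^2}(R_{ik}g_{jl}-R_{il}g_{jk}+R_{jl}g_{ik}-R_{jk}g_{il})\\ &+\frac{2}{n-2}(R_{ik}R_{jl}-R_{jk}R_{il})+\frac{2(R^2-|\mathrm{Ric}|^2)}{(n-1)(n-2)^2}(g_{ik}g_{jl}-g_{il}g_{jk}), \end{aligned} $$ where $D_{ijkl}=g^{pq}g^{rs}W_{pijr}W_{slkq}$.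
   Context: Repeated indices are summed. The computation is in a fixed (time-independent) local coordinate frame, not a moving frame. The Riemann curvature operator is $\mathrm{Riem}(X,Y)Z=\nabla_Y\nabla_XZ-\nabla_X\nabla_YZ+\nabla_{[X,Y]}Z$; in local coordinates $R^l_{ijk}\frac{\partial}{\partial x^l}=\mathrm{Riem}\bigl(\frac{\partial}{\partial x^i},\frac{\partial}{\partial x^j}\bigr)\frac{\partial}{\partial x^k}$ and $R_{ijkl}=g_{lm}R^m_{ijk}$ (so that on the round sphere $R_{ijkl}v^iw^jv^kw^l>0$ for linearly independent $v,w$). The Ricci tensor is $R_{ik}=g^{jl}R_{ijkl}$ (also denoted $\mathrm{Ric}$), and $R=g^{ik}R_{ik}$ is the scalar curvature. The Weyl tensor is defined, for $n\ge3$, by $$W_{ijkl}=R_{ijkl}+\frac{R}{(n-1)(n-2)}(g_{ik}g_{jl}-g_{il}g_{jk})-\frac{1}{n-2}(R_{ik}g_{jl}-R_{il}g_{jk}+R_{jl}g_{ik}-R_{jk}g_{il}).$$ $\Delta=g^{pq}\nabla_p\nabla_q$ is the rough Laplacian of $g(t)$ on tensors. All geometric quantities are those of $g(t)$. *)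

(* Defs.v *)
From HB Require Import structures.
From mathcomp Require Import all_boot all_order all_algebra.
From mathcomp Require Import all_classical all_reals all_analysis.

Set Implicit Arguments.
Unset Strict Implicit.
Unset Printing Implicit Defensive.

Import Order.TTheory GRing.Theory Num.Theory.
Import numFieldNormedType.Exports.

Local Open Scope classical_set_scope.
Local Open Scope ring_scope.

Definition basis_vec (R : realType) (n : nat) (i : 'I_n) : 'rV[R]_n :=
  delta_mx 0 i.

Definition partial (R : realType) (n : nat) (i : 'I_n) (f : 'rV[R]_n -> R)
  (x : 'rV[R]_n) : R := 'D_(basis_vec R i) f x.

(* The time derivative is taken within the time interval [I]: it is two-sided
   at interior times and one-sided at the end points belonging to [I]. *)
Definition tquot (R : realType) (f : R -> R) (t s : R) : R :=
  (s - t)^-1 * (f s - f t).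

Definition tderivable (R : realType) (I : set R) (f : R -> R) (t : R) : Prop :=
  cvg (tquot f t s @[s --> within I t^']).

Definition tderive (R : realType) (I : set R) (f : R -> R) (t : R) : R :=
  lim (tquot f t s @[s --> within I t^']).

(* C^k on V; V is meant to be open. *)
Fixpoint Ck (R : realType) (n k : nat) (V : set 'rV[R]_n)
    (f : 'rV[R]_n -> R) : Prop :=
  {within V, continuous f} /\
  if k is k'.+1 then
    forall i : 'I_n,
      (forall x, V x -> derivable f x (basis_vec R i)) /\
      Ck k' V (partial i f)
  else True.

Definition smooth (R : realType) (n : nat) (V : set 'rV[R]_n)
  (f : 'rV[R]_n -> R) : Prop := forall k, Ck k V f.

(* C^k jointly in (t, x) on I * V, up to the end points of I lying in I. *)
Fixpoint Ck_time (R : realType) (n k : nat) (I : set R) (V : set 'rV[R]_n)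
    (f : R -> 'rV[R]_n -> R) : Prop :=
  {within I `*` V, continuous (fun p : R * 'rV[R]_n => f p.1 p.2)} /\
  if k is k'.+1 then
    [/\ forall t x, I t -> V x -> tderivable I (f^~ x) t,
        Ck_time k' I V (fun t x => tderive I (f^~ x) t)
      & forall i : 'I_n,
          (forall t x, I t -> V x -> derivable (f t) x (basis_vec R i)) /\
          Ck_time k' I V (fun t => partial i (f t))]
  else True.

Definition smooth_time (R : realType) (n : nat) (I : set R) (V : set 'rV[R]_n)
  (f : R -> 'rV[R]_n -> R) : Prop := forall k, Ck_time k I V f.

(* A smooth n-manifold, given by an arbitrary (possibly maximal) smooth atlas:
   the chart [c] is the homeomorphism [coord c] from the open set [dom c] onto
   an open subset of R^n, with inverse [param c]. *)
Record smooth_manifold (R : realType) (n : nat) := SmoothManifold {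
  carrier :> topologicalType;
  carrier_hausdorff : hausdorff_space carrier;
  carrier_second_countable : @second_countable carrier;
  chart : Type;
  dom : chart -> set carrier;
  coord : chart -> carrier -> 'rV[R]_n;
  param : chart -> 'rV[R]_n -> carrier;
  dom_open : forall c, open (dom c);
  dom_cover : forall p, exists c, dom c p;
  coord_open : forall c, open (coord c @` dom c);
  coordK : forall c p, dom c p -> param c (coord c p) = p;
  coord_continuous : forall c, {within dom c, continuous (coord c)};
  param_continuous :
    forall c, {within coord c @` dom c, continuous (param c)};
  transition_smooth : forall (c d : chart) (k : 'I_n),
    smooth (coord c @` (dom c `&` dom d))
      (fun x => coord d (param c x) 0 k)
}.

Definition chart_image (R : realType) (n : nat) (M : smooth_manifold R n)
  (c : chart M) : set 'rV[R]_n := coord c @` dom c.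

(* A time-dependent Riemannian metric on M, for times in I: [metric c t x] is
   the matrix (g_ij) in the chart [c], at time t and at the point of
   coordinates x. *)
Record metric_family (R : realType) (n : nat) (M : smooth_manifold R n)
    (I : set R) := MetricFamily {
  metric :> chart M -> R -> 'rV[R]_n -> 'M[R]_n;
  metric_smooth : forall (c : chart M) (i j : 'I_n),
    smooth_time I (chart_image c) (fun t x => metric c t x i j);
  metric_sym : forall (c : chart M) t x, I t -> chart_image c x ->
    (metric c t x)^T = metric c t x;
  metric_posdef : forall (c : chart M) t x, I t -> chart_image c x ->
    forall v : 'rV[R]_n, v != 0 -> 0 < (v *m metric c t x *m v^T) 0 0;
  metric_transition : forall (c d : chart M) t x, I t ->
    (coord c @` (dom c `&` dom d)) x ->
    forall i j : 'I_n,
      metric c t x i j =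
      \sum_k \sum_l
        partial i (fun y => coord d (param c y) 0 k) x *
        partial j (fun y => coord d (param c y) 0 l) x *
        metric d t (coord d (param c x)) k l
}.

(* Below, [G] is the matrix of a Riemannian metric in local coordinates, at a
   fixed time. *)

Definition ginv (R : realType) (n : nat) (G : 'rV[R]_n -> 'M[R]_n)
  (i j : 'I_n) (x : 'rV[R]_n) : R := invmx (G x) i j.

(* [christoffel G k i j] is Gamma^k_ij, for the Levi-Civita connection. *)
Definition christoffel (R : realType) (n : nat) (G : 'rV[R]_n -> 'M[R]_n)
  (k i j : 'I_n) (x : 'rV[R]_n) : R :=
  2^-1 * \sum_l ginv G k l x *
    (partial i (fun y => G y j l) x + partial j (fun y => G y i l) x
     - partial l (fun y => G y i j) x).

(* Vector fields are given by their components in the coordinate frame. *)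
Definition frame (R : realType) (n : nat) (i : 'I_n) :
  'rV[R]_n -> 'rV[R]_n := fun=> basis_vec R i.

Definition nabla_vf (R : realType) (n : nat) (G : 'rV[R]_n -> 'M[R]_n)
  (X Y : 'rV[R]_n -> 'rV[R]_n) : 'rV[R]_n -> 'rV[R]_n := fun x =>
  \row_k \sum_i X x 0 i *
    (partial i (fun y => Y y 0 k) x
     + \sum_j christoffel G k i j x * Y x 0 j).

Definition lie_bracket (R : realType) (n : nat)
  (X Y : 'rV[R]_n -> 'rV[R]_n) : 'rV[R]_n -> 'rV[R]_n := fun x =>
  \row_k \sum_i (X x 0 i * partial i (fun y => Y y 0 k) x
                 - Y x 0 i * partial i (fun y => X y 0 k) x).

(* Sign convention: Riem(X,Y)Z = nabla_Y nabla_X Z - nabla_X nabla_Y Z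
   + nabla_[X,Y] Z, so that R_ijij > 0 (i <> j) on the round sphere. *)
Definition riem_op (R : realType) (n : nat) (G : 'rV[R]_n -> 'M[R]_n)
  (X Y Z : 'rV[R]_n -> 'rV[R]_n) : 'rV[R]_n -> 'rV[R]_n := fun x =>
  nabla_vf G Y (nabla_vf G X Z) x - nabla_vf G X (nabla_vf G Y Z) x
  + nabla_vf G (lie_bracket X Y) Z x.

(* [riem_up G l i j k] is R^l_ijk and [riem G i j k l] is R_ijkl. *)
Definition riem_up (R : realType) (n : nat) (G : 'rV[R]_n -> 'M[R]_n)
  (l i j k : 'I_n) (x : 'rV[R]_n) : R :=
  riem_op G (frame i) (frame j) (frame k) x 0 l.

Definition riem (R : realType) (n : nat) (G : 'rV[R]_n -> 'M[R]_n)
  (i j k l : 'I_n) (x : 'rV[R]_n) : R :=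
  \sum_m G x l m * riem_up G m i j k x.

Definition ricci (R : realType) (n : nat) (G : 'rV[R]_n -> 'M[R]_n)
  (i k : 'I_n) (x : 'rV[R]_n) : R :=
  \sum_j \sum_l ginv G j l x * riem G i j k l x.

Definition scal (R : realType) (n : nat) (G : 'rV[R]_n -> 'M[R]_n)
  (x : 'rV[R]_n) : R := \sum_i \sum_k ginv G i k x * ricci G i k x.

Definition ricci_norm2 (R : realType) (n : nat) (G : 'rV[R]_n -> 'M[R]_n)
  (x : 'rV[R]_n) : R :=
  \sum_i \sum_j \sum_k \sum_l
    ginv G i k x * ginv G j l x * ricci G i j x * ricci G k l x.

Definition weyl (R : realType) (n : nat) (G : 'rV[R]_n -> 'M[R]_n)
  (i j k l : 'I_n) (x : 'rV[R]_n) : R :=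
  let g a b := G x a b in
  let Ric a b := ricci G a b x in
  riem G i j k l x
  + scal G x / ((n%:R - 1) * (n%:R - 2)) * (g i k * g j l - g i l * g j k)
  - (n%:R - 2)^-1 *
    (Ric i k * g j l - Ric i l * g j k + Ric j l * g i k - Ric j k * g i l).

(* Components of a covariant tensor field of order 4, resp. 5. *)
Definition tensor4 (R : realType) (n : nat) : Type :=
  'I_n -> 'I_n -> 'I_n -> 'I_n -> 'rV[R]_n -> R.

Definition tensor5 (R : realType) (n : nat) : Type := 'I_n -> tensor4 R n.

(* [nabla4 G T p i j k l] is nabla_p T_ijkl. *)
Definition nabla4 (R : realType) (n : nat) (G : 'rV[R]_n -> 'M[R]_n)
  (T : tensor4 R n) : tensor5 R n := fun p i j k l x =>
  partial p (T i j k l) x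
  - \sum_m (christoffel G m p i x * T m j k l x
            + christoffel G m p j x * T i m k l x
            + christoffel G m p k x * T i j m l x
            + christoffel G m p l x * T i j k m x).

(* [nabla5 G S p q i j k l] is nabla_p S_qijkl. *)
Definition nabla5 (R : realType) (n : nat) (G : 'rV[R]_n -> 'M[R]_n)
  (S : tensor5 R n) : 'I_n -> tensor5 R n := fun p q i j k l x =>
  partial p (S q i j k l) x
  - \sum_m (christoffel G m p q x * S m i j k l x
            + christoffel G m p i x * S q m j k l x
            + christoffel G m p j x * S q i m k l x
            + christoffel G m p k x * S q i j m l x
            + christoffel G m p l x * S q i j k m x).

Definition rough_laplacian (R : realType) (n : nat)
  (G : 'rV[R]_n -> 'M[R]_n) (T : tensor4 R n) : tensor4 R n :=
  fun i j k l x =>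
  \sum_p \sum_q ginv G p q x * nabla5 G (nabla4 G T) p q i j k l x.

Definition weylD (R : realType) (n : nat) (G : 'rV[R]_n -> 'M[R]_n)
  (i j k l : 'I_n) (x : 'rV[R]_n) : R :=
  \sum_p \sum_q \sum_r \sum_s
    ginv G p q x * ginv G r s x * weyl G p i j r x * weyl G s l k q x.

Definition ricci_flow (R : realType) (n : nat) (M : smooth_manifold R n)
  (I : set R) (g : metric_family M I) : Prop :=
  forall (c : chart M) t x, I t -> chart_image c x ->
  forall i j : 'I_n,
    tderive I (fun s => g c s x i j) t = - 2 * ricci (g c t) i j x.

(* Main.v *)
Require Import Defs.
From HB Require Import structures.
From mathcomp Require Import all_boot all_order all_algebra.
From mathcomp Require Import all_classical all_reals all_analysis.
From mathcomp Require Import ring lra.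

Set Implicit Arguments.
Unset Strict Implicit.
Unset Printing Implicit Defensive.

Import Order.TTheory GRing.Theory Num.Theory.
Import numFieldNormedType.Exports.

Local Open Scope classical_set_scope.
Local Open Scope ring_scope.

(** Fix a chart. All the geometric quantities are then obtained from the
    functions g_ij(t, x) by ring operations, by inverting a determinant that
    vanishes nowhere, and by differentiating in x and in t. Smooth functions on
    I x V form a commutative ring on which the partial derivatives and the time
    derivative act as derivations that commute with each other ([der_comm],
    from [schwarz]; the time derivative may be one-sided at the ends of I). The
    identity is therefore proved in an arbitrary commutative ring with commuting
    derivations ([weyl_evolution]) and read off at the event (t, x).

    In such a ring tensors are functions on lists of indices. The Ricci identity
    holds in every rank by induction on the list ([covd_comm]); applied to the
    metric it gives the antisymmetry of the curvature in its last two indices,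
    and the Jacobi identity for covariant derivatives gives the second Bianchi
    identity ([riemann_bianchi2]).

    Under the flow the connection varies by first derivatives of Ric
    ([dt_levi]), hence the curvature varies by second derivatives of Ric and by
    the action of Ric on R ([dt_riemann]). On the other hand the second Bianchi
    identity, the Ricci identity and the contracted Bianchi identity express the
    Laplacian of R by the same second derivatives of Ric and by terms quadratic
    in R ([laplacian_riemann]). The difference is an equation without
    derivatives on the right-hand side,

      (d/dt - Laplacian) R_ijkl
        = 2 (B_ijkl - B_ijlk + B_ikjl - B_iljk) - (Ric acting on R)_ijkl

    ([riemann_evolution]); traces of it give the equations of Ric and S.

    Since g is parallel, the Laplacian passes through the definition of W, and
    what is left is algebra ([weyl_reaction]): write R = W + h /\ g with h the
    Schouten tensor. As W is trace-free, the products of W with h /\ g contribute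
    only the contraction of h with W ([quad_sum_cross]), which cancels against
    the same contraction in the evolution of Ric; the square of h /\ g gives the
    remaining terms in Ric, S and g ([quad_sum_kn_kn]). *)

(** * Metric traces *)

Section Contraction.
Variables (A : comPzRingType) (n : nat).
Variables (g gi : 'I_n -> 'I_n -> A).
Hypothesis gsym : forall i j, g i j = g j i.
Hypothesis gisym : forall i j, gi i j = gi j i.
Hypothesis gV : forall i j, \sum_k gi i k * g k j = (i == j)%:R.

Definition tr (f : 'I_n -> 'I_n -> A) : A := \sum_a \sum_b gi a b * f a b.

Lemma eq_tr f f' : (forall a b, f a b = f' a b) -> tr f = tr f'.
Proof. by move=> e; apply: eq_bigr => a _; apply: eq_bigr => b _; rewrite e. Qed.

Lemma trD f f' : tr (fun a b => f a b + f' a b) = tr f + tr f'.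
Proof.
rewrite /tr -big_split; apply: eq_bigr => a _ /=.
by rewrite -big_split; apply: eq_bigr => b _ /=; rewrite mulrDr.
Qed.

Lemma trZ c f : tr (fun a b => c * f a b) = c * tr f.
Proof.
rewrite /tr big_distrr; apply: eq_bigr => a _ /=.
by rewrite big_distrr; apply: eq_bigr => b _ /=; rewrite mulrCA.
Qed.

Lemma trZr c f : tr (fun a b => f a b * c) = tr f * c.
Proof. by rewrite mulrC -trZ; apply: eq_tr => a b; rewrite mulrC. Qed.

Lemma trN f : tr (fun a b => - f a b) = - tr f.
Proof. by rewrite -mulN1r -trZ; apply: eq_tr => a b; rewrite mulN1r. Qed.

Lemma trB f f' : tr (fun a b => f a b - f' a b) = tr f - tr f'.
Proof. by rewrite trD trN. Qed.

Lemma tr_swap f : tr (fun a b => f b a) = tr f.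
Proof.
rewrite /tr exchange_big; apply: eq_bigr => a _; apply: eq_bigr => b _.
by rewrite gisym.
Qed.

Lemma tr_sum (J : Type) (r : seq J) (P : pred J) f :
  tr (fun a b => \sum_(j <- r | P j) f j a b) = \sum_(j <- r | P j) tr (f j).
Proof.
rewrite /tr [RHS]exchange_big; apply: eq_bigr => a _ /=.
by rewrite [RHS]exchange_big; apply: eq_bigr => b _ /=; rewrite big_distrr.
Qed.

Lemma tr_exch f :
  tr (fun a b => tr (fun c e => f a b c e)) =
  tr (fun c e => tr (fun a b => f a b c e)).
Proof.
rewrite {2}/tr tr_sum; apply: eq_bigr => c _; rewrite tr_sum.
by apply: eq_bigr => e _; rewrite trZ.
Qed.

Lemma sum_delta i (v : 'I_n -> A) : \sum_k (i == k)%:R * v k = v i.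
Proof.
rewrite (bigD1 i) //= eqxx mul1r big1 ?addr0 // => k /negbTE ki.
by rewrite eq_sym ki mul0r.
Qed.

Lemma tr_g i v : tr (fun a b => g i a * v b) = v i.
Proof.
rewrite -tr_swap /tr; under eq_bigr => a _.
  under eq_bigr => b _ do rewrite [g i b]gsym mulrA.
  rewrite -big_distrl /= gV.
  over.
by under eq_bigr do rewrite eq_sym; rewrite sum_delta.
Qed.

Lemma tr_gl i v : tr (fun a b => g a i * v b) = v i.
Proof. by rewrite -[RHS](tr_g i v); apply: eq_tr => a b; rewrite gsym. Qed.

Lemma tr_gr i v : tr (fun a b => v a * g b i) = v i.
Proof. by rewrite -tr_swap -[RHS](tr_gl i v); apply: eq_tr => a b; rewrite mulrC. Qed.

Lemma tr_gg : tr g = n%:R.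
Proof.
rewrite /tr; under eq_bigr => a _.
  under eq_bigr => b _ do rewrite gsym.
  rewrite gV eqxx; over.
by rewrite sumr_const card_ord.
Qed.

End Contraction.

(** * Covariant derivatives in a ring with derivations *)

Definition derivation (A : comPzRingType) (d : A -> A) : Prop :=
  (forall x y, d (x + y) = d x + d y) /\ (forall x y, d (x * y) = d x * y + x * d y).

Section Derivations.
Variables (A : comPzRingType) (d : A -> A).
Hypothesis dP : derivation d.

Lemma derD x y : d (x + y) = d x + d y. Proof. exact: dP.1. Qed.
Lemma derM x y : d (x * y) = d x * y + x * d y. Proof. exact: dP.2. Qed.
Lemma der0 : d 0 = 0.
Proof. by apply: (addrI (d 0)); rewrite -derD !addr0. Qed.
Lemma derN x : d (- x) = - d x.
Proof. by apply: (addrI (d x)); rewrite -derD !subrr der0. Qed.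
Lemma derB x y : d (x - y) = d x - d y. Proof. by rewrite derD derN. Qed.
Lemma der1 : d 1 = 0.
Proof. by apply: (addrI (d 1)); have := derM 1 1; rewrite !mulr1 mul1r addr0 => <-. Qed.
Lemma der_nat m : d m%:R = 0.
Proof. by elim: m => [|m IH]; rewrite ?der0 // mulrS derD der1 IH addr0. Qed.
Lemma der_sum (J : Type) (r : seq J) (P : pred J) (F : J -> A) :
  d (\sum_(j <- r | P j) F j) = \sum_(j <- r | P j) d (F j).
Proof. exact: (big_morph d derD der0). Qed.

(** This is how 1/2, 1/(n-1) and 1/(n-2) are seen to be constants. *)
Lemma der_inverse_const c u : c * u = 1 -> d u = 0 -> d c = 0.
Proof.
move=> cu du; have e : d (c * u) = 0 by rewrite cu der1.
rewrite derM du mulr0 addr0 in e.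
by rewrite -[d c]mulr1 -[in LHS]cu mulrCA e mulr0.
Qed.

End Derivations.

Section Connection.
Variables (A : comPzRingType) (n : nat) (d : 'I_n -> A -> A).
Hypothesis dP : forall p, derivation (d p).
Hypothesis dC : forall p q x, d p (d q x) = d q (d p x).
Variable Gam : 'I_n -> 'I_n -> 'I_n -> A.
Hypothesis Gsym : forall p q m, Gam p q m = Gam q p m.

Local Notation tensor := (seq 'I_n -> A).


(** Tensors are functions on lists of indices, so that a single recursion
    gives the covariant derivative in every rank; only the values on lists
    of the intended length matter. The direction p is a parameter here and
    becomes the first index in [nabla]. *)
Fixpoint covd (p : 'I_n) (s : seq 'I_n) (T : tensor) : A :=
  if s is i :: s' then
    covd p s' (fun u => T (i :: u)) - \sum_m Gam p i m * T (m :: s')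
  else d p (T [::]).

Definition nabla (T : tensor) : tensor :=
  fun s => if s is p :: s' then covd p s' T else 0.

Lemma eq_covd p s T T' :
  (forall u, size u = size s -> T u = T' u) -> covd p s T = covd p s T'.
Proof.
elim: s T T' => [|i s IH] T T' e /=; first by rewrite e.
congr (_ - _); first by apply: IH => u us; apply: e; rewrite /= us.
by apply: eq_bigr => m _; rewrite e.
Qed.

Lemma covdD p s T T' :
  covd p s (fun u => T u + T' u) = covd p s T + covd p s T'.
Proof.
elim: s T T' => [|i s IH] T T' /=; first by rewrite (derD (dP p)).
rewrite (IH (fun u => T (i :: u)) (fun u => T' (i :: u))).
under eq_bigr do rewrite mulrDr.
by rewrite big_split /=; ring.
Qed.

Lemma covdM p s c T :
  covd p s (fun u => c * T u) = d p c * T s + c * covd p s T.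
Proof.
elim: s T => [|i s IH] T /=; first by rewrite (derM (dP p)).
rewrite (IH (fun u => T (i :: u))).
under eq_bigr do rewrite mulrCA.
by rewrite -big_distrr /=; ring.
Qed.

Lemma covd0 p s : covd p s (fun=> 0) = 0.
Proof.
elim: s => [|i s IH] /=; first by rewrite (der0 (dP p)).
by rewrite IH big1 ?subr0 // => m _; rewrite mulr0.
Qed.

Lemma covdZ p s c T : d p c = 0 ->
  covd p s (fun u => c * T u) = c * covd p s T.
Proof. by move=> dc; rewrite covdM dc mul0r add0r. Qed.

Lemma covdN p s T : covd p s (fun u => - T u) = - covd p s T.
Proof.
have d1 : d p (-1) = 0 by rewrite (derN (dP p)) (der1 (dP p)) oppr0.
rewrite -mulN1r -(covdZ _ _ d1).
by apply: eq_covd => u _; rewrite mulN1r.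
Qed.

Lemma covdB p s T T' :
  covd p s (fun u => T u - T' u) = covd p s T - covd p s T'.
Proof. by rewrite covdD covdN. Qed.

Lemma covd_sum (J : Type) (r : seq J) p s (T : J -> tensor) :
  covd p s (fun u => \sum_(j <- r) T j u) = \sum_(j <- r) covd p s (T j).
Proof.
elim: r => [|j r IH].
  rewrite big_nil -[RHS](covd0 p s); apply: eq_covd => u _.
  by rewrite big_nil.
rewrite big_cons -IH -covdD; apply: eq_covd => u _.
by rewrite big_cons.
Qed.

(** The curvature R^o_pqi; its sign is the one for which the operator
    [nabla_p, nabla_q] sends the covector T_i to R^o_pqi T_o. *)
Definition curv (p q i o : 'I_n) : A :=
  d q (Gam p i o) - d p (Gam q i o)
  + \sum_m (Gam p i m * Gam q m o - Gam q i m * Gam p m o).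

(** The curvature acting as a derivation on all the indices of a tensor. *)
Fixpoint curv_act (p q : 'I_n) (s : seq 'I_n) (T : tensor) : A :=
  if s is i :: s' then
    curv_act p q s' (fun u => T (i :: u)) + \sum_o curv p q i o * T (o :: s')
  else 0.

(** The Ricci identity in every rank. Peeling off one index, the products
    of a connection coefficient with a derivative cancel in the commutator,
    and what remains on that index is the curvature. *)
Lemma covd_comm p q s T :
  covd p s (fun u => covd q u T) - covd q s (fun u => covd p u T)
  = curv_act p q s T.
Proof.
elim: s T => [|i s IH] T /=; first by rewrite dC subrr.
pose D p q := covd p s (fun u => covd q u (fun v => T (i :: v))).
have expand p' q' :
  covd p' s (fun u => covd q' u (fun v => T (i :: v))
                      - \sum_m Gam q' i m * T (m :: u)) =
  D p' q' - \sum_m d p' (Gam q' i m) * T (m :: s)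
  - \sum_m Gam q' i m * covd p' s (fun u => T (m :: u)).
  rewrite covdB (covd_sum _ _ _ (fun m u => Gam q' i m * T (m :: u))) /D.
  under eq_bigr => m _ do rewrite (covdM _ _ _ (fun u => T (m :: u))).
  by rewrite big_split /=; ring.
have expand2 p' q' :
  \sum_m Gam p' i m * (covd q' s (fun u => T (m :: u))
                       - \sum_o Gam q' m o * T (o :: s)) =
  \sum_m Gam p' i m * covd q' s (fun u => T (m :: u)) -
  \sum_o (\sum_m Gam p' i m * Gam q' m o) * T (o :: s).
  under eq_bigr do rewrite mulrBr.
  rewrite big_split /= sumrN; congr (_ - _).
  under [RHS]eq_bigr do rewrite big_distrl /=.
  rewrite [RHS]exchange_big /=; apply: eq_bigr => m _.
  by rewrite big_distrr; apply: eq_bigr => o _ /=; rewrite mulrA.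
rewrite !expand !expand2 -IH -/(D p q) -/(D q p).
have -> : \sum_o curv p q i o * T (o :: s) =
  \sum_o d q (Gam p i o) * T (o :: s) - \sum_o d p (Gam q i o) * T (o :: s)
  + \sum_o (\sum_m Gam p i m * Gam q m o) * T (o :: s)
  - \sum_o (\sum_m Gam q i m * Gam p m o) * T (o :: s).
  rewrite -!sumrB -!big_split /= -sumrB; apply: eq_bigr => o _.
  by rewrite /curv sumrB; ring.
ring.
Qed.

(** Here the second derivative also acts on the index of the first one;
    that contribution is symmetric because the connection has no torsion. *)
Lemma nabla2_comm p q s T :
  nabla (nabla T) (p :: q :: s) - nabla (nabla T) (q :: p :: s)
  = curv_act p q s T.
Proof.
rewrite /= -covd_comm.
under [X in _ - (_ - X)]eq_bigr do rewrite Gsym.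
by ring.
Qed.

Lemma curv_cyclic p q i o : curv p q i o + curv q i p o + curv i p q o = 0.
Proof.
rewrite /curv !sumrB (Gsym q i o) (Gsym p i o) (Gsym q p o).
have S a b c : \sum_m Gam a b m * Gam c m o = \sum_m Gam b a m * Gam c m o.
  by apply: eq_bigr => m _; rewrite Gsym.
rewrite (S i p q) (S i q p) (S q p i).
ring.
Qed.

End Connection.

(** * The Levi-Civita connection and the Bianchi identities *)

Section CovdMul.
Variables (A : comPzRingType) (n : nat) (d : 'I_n -> A -> A).
Hypothesis dP : forall p, derivation (d p).
Variable Gam : 'I_n -> 'I_n -> 'I_n -> A.
Local Notation covd := (covd d Gam).

(** The Leibniz rule for a tensor product. The mask tells which slots
    belong to the first factor, which covers all the interleavings that
    occur in g_ik g_jl - g_il g_jk and its relatives. *)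
Lemma covd_mul p m s (X Y : seq 'I_n -> A) : size m = size s ->
  covd p s (fun u => X (mask m u) * Y (mask (map negb m) u))
  = covd p (mask m s) X * Y (mask (map negb m) s)
    + X (mask m s) * covd p (mask (map negb m) s) Y.
Proof.
elim: m s X Y => [|[] m IH] [|i s] X Y //= => [_|[sm]|[sm]].
- by rewrite (derM (dP p)).
- rewrite (IH s (fun u => X (i :: u)) Y sm).
  under eq_bigr do rewrite mulrA.
  by rewrite -big_distrl /=; ring.
- rewrite (IH s X (fun u => Y (i :: u)) sm).
  under eq_bigr do rewrite mulrCA.
  by rewrite -big_distrr /=; ring.
Qed.

End CovdMul.

Section Tensors.
Variables (A : comPzRingType) (n : nat).
Definition tens0 (f : A) : seq 'I_n -> A := fun s => if s is [::] then f else 0.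
Definition tens1 (f : 'I_n -> A) : seq 'I_n -> A :=
  fun s => if s is [:: i] then f i else 0.
Definition tens2 (f : 'I_n -> 'I_n -> A) : seq 'I_n -> A :=
  fun s => if s is [:: i; j] then f i j else 0.
Definition tens4 (f : 'I_n -> 'I_n -> 'I_n -> 'I_n -> A) : seq 'I_n -> A :=
  fun s => if s is [:: i; j; k; l] then f i j k l else 0.
End Tensors.

Section LeviCivita.
Variables (A : comPzRingType) (n : nat) (d : 'I_n -> A -> A).
Hypothesis dP : forall p, derivation (d p).
Hypothesis dC : forall p q x, d p (d q x) = d q (d p x).
Variables (g gi : 'I_n -> 'I_n -> A) (half : A).
Hypothesis halfP : half + half = 1.
Hypothesis gsym : forall i j, g i j = g j i.
Hypothesis gisym : forall i j, gi i j = gi j i.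
Hypothesis gV : forall i j, \sum_k gi i k * g k j = (i == j)%:R.
Local Notation tr := (tr gi).

Lemma metric_inverse_r i j : \sum_k g i k * gi k j = (i == j)%:R.
Proof.
by rewrite eq_sym -gV; apply: eq_bigr => k _; rewrite mulrC gsym gisym.
Qed.

Lemma raise_lower (v : 'I_n -> A) i : \sum_k gi i k * \sum_l g k l * v l = v i.
Proof.
under eq_bigr do rewrite big_distrr /=.
rewrite exchange_big /= -[RHS]sum_delta; apply: eq_bigr => l _.
by rewrite -gV big_distrl; apply: eq_bigr => k _; rewrite mulrA.
Qed.

Lemma lower_raise (v : 'I_n -> A) i : \sum_k g i k * \sum_l gi k l * v l = v i.
Proof.
under eq_bigr do rewrite big_distrr /=.
rewrite exchange_big /= -[RHS]sum_delta; apply: eq_bigr => l _.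
by rewrite -metric_inverse_r big_distrl; apply: eq_bigr => k _; rewrite mulrA.
Qed.

Definition levi (p i m : 'I_n) : A :=
  half * \sum_l gi m l * (d p (g i l) + d i (g p l) - d l (g p i)).

Lemma levi_sym p i m : levi p i m = levi i p m.
Proof.
congr (_ * _); apply: eq_bigr => l _; rewrite (gsym p i); ring.
Qed.

Lemma levi_lower p i l :
  \sum_m g l m * levi p i m = half * (d p (g i l) + d i (g p l) - d l (g p i)).
Proof.
rewrite -[in RHS](lower_raise (fun l => d p (g i l) + d i (g p l) - d l (g p i))).
by rewrite big_distrr; apply: eq_bigr => m _; rewrite /levi mulrCA.
Qed.

Lemma metric_compatible p i j :
  d p (g i j) = \sum_m levi p i m * g m j + \sum_m levi p j m * g i m.
Proof.
under eq_bigr do rewrite mulrC gsym.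
under [X in _ + X]eq_bigr do rewrite mulrC.
rewrite !levi_lower (gsym j i) (gsym p j) (gsym p i) -[LHS]mul1r -halfP.
ring.
Qed.

(** Differentiate gi * g = 1. It applies to the partial derivatives and to
    the time derivative alike. *)
Lemma derivation_inverse (D : A -> A) i j : derivation D ->
  D (gi i j) = - \sum_k \sum_l gi i k * D (g k l) * gi l j.
Proof.
move=> DP.
have e l : \sum_k D (gi i k) * g k l = - \sum_k gi i k * D (g k l).
  apply/eqP; rewrite -addr_eq0 -big_split /=.
  rewrite (eq_bigr (fun k => D (gi i k * g k l))) => [|k _]; last by rewrite (derM DP).
  by rewrite -(der_sum DP) gV (der_nat DP).
transitivity (\sum_l (\sum_k D (gi i k) * g k l) * gi l j).
  under eq_bigr do rewrite big_distrl /=.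
  rewrite exchange_big /= -[LHS](sum_delta j (fun k => D (gi i k))).
  apply: eq_bigr => k _; under eq_bigr do rewrite -mulrA.
  by rewrite -big_distrr /= metric_inverse_r mulrC eq_sym.
rewrite exchange_big /= -sumrN; apply: eq_bigr => l _.
by rewrite e mulNr big_distrl.
Qed.

Lemma inverse_metric_compatible p i j :
  d p (gi i j) = - (\sum_m levi p m i * gi m j + \sum_m levi p m j * gi i m).
Proof.
rewrite (derivation_inverse _ _ (dP p)); congr (- _).
transitivity (\sum_k \sum_l (gi i k * (\sum_m levi p k m * g m l) * gi l j +
   (gi i k * (\sum_m g k m * levi p l m) * gi l j))).
  apply: eq_bigr => k _; apply: eq_bigr => l _; rewrite metric_compatible.
  under [X in _ + X]eq_bigr do rewrite mulrC.
  ring.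
under eq_bigr do rewrite big_split /=.
rewrite big_split /= addrC; congr (_ + _).
  rewrite exchange_big /=; apply: eq_bigr => l _.
  by rewrite -big_distrl /= raise_lower.
apply: eq_bigr => k _; rewrite -[RHS]mulrC.
under eq_bigr do rewrite -mulrA.
rewrite -big_distrr /=; congr (_ * _).
under eq_bigr do rewrite big_distrl /=.
rewrite exchange_big /= -[RHS](sum_delta j (levi p k)).
apply: eq_bigr => m _; under eq_bigr do rewrite -mulrA.
by rewrite -big_distrr /= metric_inverse_r mulrC eq_sym.
Qed.

Local Notation covd := (covd d levi).
Local Notation nabla := (nabla d levi).
Local Notation curv := (curv d levi).
Local Notation curv_act := (curv_act d levi).

(** The inverse metric is parallel, so covariant differentiation commutes
    with traces. *)
Lemma covd_tr p s T :
  covd p s (fun u => tr (fun a b => T (a :: b :: u)))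
  = tr (fun a b => covd p (a :: b :: s) T).
Proof.
rewrite (covd_sum dP _ _ _ _ (fun a u => \sum_b gi a b * T (a :: b :: u))).
transitivity (\sum_a \sum_b (d p (gi a b) * T (a :: b :: s) +
   gi a b * covd p s (fun u => T (a :: b :: u)))).
  apply: eq_bigr => a _; rewrite (covd_sum dP _ _ _ _ (fun b u => gi a b * T (a :: b :: u))).
  by apply: eq_bigr => b _; rewrite (covdM dP _ _ _ _ (fun u => T (a :: b :: u))).
have E1 : \sum_a \sum_b gi a b * (\sum_m levi p b m * T [:: a, m & s]) =
          \sum_a \sum_b \sum_m levi p m b * gi a m * T [:: a, b & s].
  apply: eq_bigr => a _ /=.
  under eq_bigr do rewrite big_distrr /=.
  rewrite exchange_big /=; apply: eq_bigr => b _; apply: eq_bigr => m _; ring.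
have E2 : \sum_a \sum_b gi a b * (\sum_m levi p a m * T [:: m, b & s]) =
          \sum_a \sum_b \sum_m levi p m a * gi m b * T [:: a, b & s].
  rewrite exchange_big [RHS]exchange_big; apply: eq_bigr => b _ /=.
  under eq_bigr do rewrite big_distrr /=.
  rewrite exchange_big /=; apply: eq_bigr => a _; apply: eq_bigr => m _; ring.
rewrite /tr; under [RHS]eq_bigr do under eq_bigr do rewrite /= !mulrBr.
under [RHS]eq_bigr do rewrite !sumrB.
rewrite !sumrB E1 E2 -!sumrB; apply: eq_bigr => a _; rewrite -!sumrB.
apply: eq_bigr => b _; rewrite inverse_metric_compatible -!big_distrl /=; ring.
Qed.

Lemma curvN p q i o : curv p q i o = - curv q p i o.
Proof. by rewrite /curv !sumrB; ring. Qed.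

Definition riemann (i j k l : 'I_n) : A := \sum_m g l m * curv i j k m.

Lemma curv_raise i j k o : curv i j k o = \sum_l gi o l * riemann i j k l.
Proof. by rewrite raise_lower. Qed.

Lemma curv_sumE p q i (f : 'I_n -> A) :
  \sum_o curv p q i o * f o = tr (fun o l => riemann p q i l * f o).
Proof.
apply: eq_bigr => o _; rewrite curv_raise big_distrl; apply: eq_bigr => l _ /=.
by rewrite mulrA.
Qed.

Lemma covd_metric p i j : covd p [:: i; j] (tens2 g) = 0.
Proof. by rewrite /= metric_compatible; ring. Qed.

Lemma riemann_anti1 i j k l : riemann i j k l = - riemann j i k l.
Proof.
rewrite /riemann -sumrN; apply: eq_bigr => m _.
by rewrite curvN mulrN.
Qed.

(** Apply the Ricci identity to the metric: it is parallel, so the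
    curvature acts trivially on it. *)
Lemma riemann_anti2 i j k l : riemann i j k l = - riemann i j l k.
Proof.
have Z p q : covd p [:: k; l] (fun u => covd q u (tens2 g)) = 0.
  rewrite -[RHS](covd0 dP levi p [:: k; l]); apply: eq_covd.
  by case=> [|a[|b[|]]] // _; rewrite covd_metric.
have /eqP := covd_comm dP dC levi i j [:: k; l] (tens2 g).
rewrite !Z subrr eq_sym /= add0r addr_eq0 => /eqP e.
rewrite /riemann; transitivity (\sum_o curv i j k o * tens2 g [:: o; l]).
  by apply: eq_bigr => o _; rewrite mulrC gsym.
by rewrite -[LHS]opprK -e; congr (- _); apply: eq_bigr => o _; rewrite mulrC.
Qed.

Lemma riemann_bianchi1 i j k l :
  riemann i j k l + riemann j k i l + riemann k i j l = 0.
Proof.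
rewrite /riemann -!big_split big1 // => m _ /=.
by rewrite -!mulrDr curv_cyclic ?mulr0 //; exact: levi_sym.
Qed.

(** The second Bianchi identity with the last index raised is the Jacobi
    identity for the operators covd r, covd p and covd q, here evaluated on
    the basis covector T. *)
Lemma curv_bianchi2 r p q k o :
  let D r p q := d r (curv p q k o) - \sum_m levi r k m * curv p q m o
                 + \sum_m curv p q k m * levi r m o in
  D r p q + D p q r + D q r p = 0.
Proof.
move=> D; pose T : seq 'I_n -> A := tens1 (fun i => (o == i)%:R).
pose K p q u := curv_act p q u T.
have DE r' p' q' :
  D r' p' q' = covd r' [:: k] (fun u => curv_act p' q' u T)
               - curv_act p' q' [:: k] (fun u => covd r' u T).
  rewrite /= !add0r /T /=.
  have S (v : 'I_n -> A) : \sum_i v i * (o == i)%:R = v o.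
    by rewrite -[RHS](sum_delta o); apply: eq_bigr => i _; rewrite mulrC.
  rewrite S.
  under [X in _ - X - _]eq_bigr do rewrite add0r S.
  have -> : \sum_i curv p' q' k i * (d r' (o == i)%:R -
       \sum_m levi r' i m * (o == m)%:R) = - \sum_i curv p' q' k i * levi r' i o.
    rewrite -sumrN; apply: eq_bigr => i _.
    by rewrite S (der_nat (dP r')) sub0r mulrN.
  by rewrite opprK.
have expand r' p' q' : covd r' [:: k] (fun u => curv_act p' q' u T) =
   covd r' [:: k] (fun u => covd p' u (fun v => covd q' v T))
   - covd r' [:: k] (fun u => covd q' u (fun v => covd p' v T)).
  rewrite -(covdB dP); apply: eq_covd => u _.
  by rewrite (covd_comm dP dC).
rewrite !DE !expand -!(covd_comm dP dC); ring.
Qed.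

(** Compared with [curv_bianchi2], the derivative also acts on the two form
    indices; the extra terms cancel in the cyclic sum because the
    connection has no torsion. *)
Lemma riemann_bianchi2 h i j k l :
  covd h [:: i; j; k; l] (tens4 riemann) + covd i [:: j; h; k; l] (tens4 riemann)
  + covd j [:: h; i; k; l] (tens4 riemann) = 0.
Proof.
pose D r p q o := d r (curv p q k o) - \sum_m levi r k m * curv p q m o
                 + \sum_m curv p q k m * levi r m o.
have E r p q : covd r [:: p; q; k; l] (tens4 riemann) =
  \sum_o g l o * D r p q o
  - \sum_m levi r p m * riemann m q k l - \sum_m levi r q m * riemann p m k l.
  rewrite /= /D.
  have -> : d r (riemann p q k l) = \sum_o (d r (g l o) * curv p q k o + g l o * d r (curv p q k o)).
    by rewrite (der_sum (dP r)); apply: eq_bigr => o _; rewrite (derM (dP r)).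
  have -> : \sum_m levi r k m * riemann p q m l = \sum_o g l o * \sum_m levi r k m * curv p q m o.
    under eq_bigr do rewrite big_distrr /=.
    rewrite exchange_big /=; apply: eq_bigr => o _.
    by rewrite big_distrr; apply: eq_bigr => m _ /=; ring.
  have e1 : \sum_m levi r l m * riemann p q k m = \sum_o (\sum_m levi r l m * g m o) * curv p q k o.
    under eq_bigr do rewrite big_distrr /=.
    rewrite exchange_big /=; apply: eq_bigr => o _.
    by rewrite big_distrl; apply: eq_bigr => m _ /=; ring.
  have e2 : \sum_o g l o * (\sum_m curv p q k m * levi r m o) = \sum_o (\sum_m levi r o m * g l m) * curv p q k o.
    under eq_bigr do rewrite big_distrr /=.
    rewrite exchange_big /=; apply: eq_bigr => o _.
    by rewrite big_distrl; apply: eq_bigr => m _ /=; ring.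
  under [X in _ = X - _ - _]eq_bigr do rewrite mulrDr mulrBr.
  rewrite [X in _ = X - _ - _]big_split sumrB /= e1 e2 !big_split /=.
  under eq_bigr do rewrite metric_compatible mulrDl.
  rewrite big_split /=; ring.
rewrite !E.
have G0 : \sum_o g l o * D h i j o + \sum_o g l o * D i j h o + \sum_o g l o * D j h i o = 0.
  rewrite -!big_split big1 // => o _ /=.
  by rewrite -!mulrDr curv_bianchi2 mulr0.
have S a b c : \sum_m levi a b m * riemann m c k l = - \sum_m levi b a m * riemann c m k l.
  rewrite -sumrN; apply: eq_bigr => m _.
  by rewrite levi_sym riemann_anti1 mulrN.
rewrite (S h i j) (S i j h) (S j h i).
by rewrite -[RHS]G0; ring.
Qed.

End LeviCivita.

(** * Second covariant derivatives *)

(** Adjacent transpositions generate all rearrangements of indices, and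
    they pass easily through the recursion that defines covariant
    derivatives. *)
Fixpoint swap_at (T : Type) (m : nat) (s : seq T) : seq T :=
  match m, s with
  | 0, a :: b :: s' => b :: a :: s'
  | m'.+1, a :: s' => a :: swap_at m' s'
  | _, _ => s
  end.

Section SecondDerivatives.
Variables (A : comPzRingType) (n : nat) (d : 'I_n -> A -> A).
Hypothesis dP : forall p, derivation (d p).
Variable Gam : 'I_n -> 'I_n -> 'I_n -> A.
Local Notation covd := (covd d Gam).
Local Notation nabla := (nabla d Gam).

Lemma covd_swap p m s T :
  covd p s (fun u => T (swap_at m u)) = covd p (swap_at m s) T.
Proof.
elim: m s T => [|m IH] [|a [|b s]] T //=; first by ring.
- by rewrite -(IH [::] (fun u => T (a :: u))).
- by rewrite -(IH (b :: s) (fun u => T (a :: u))).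
Qed.

Definition hess (T : seq 'I_n -> A) p q s := nabla (nabla T) (p :: q :: s).

Lemma eq_hess p q s T T' :
  (forall u, size u = size s -> T u = T' u) -> hess T p q s = hess T' p q s.
Proof.
move=> e; apply: eq_covd => -[|a u] //= [us].
by apply: eq_covd => v vs; apply: e; rewrite vs us.
Qed.

Lemma hess_swap p q m s T :
  hess (fun u => T (swap_at m u)) p q s = hess T p q (swap_at m s).
Proof.
transitivity (covd p (q :: s) (fun u => nabla T (swap_at m.+1 u))).
  by apply: eq_covd => -[|a u] //= _; rewrite covd_swap.
by rewrite covd_swap.
Qed.

Lemma hessD p q s T T' :
  hess (fun u => T u + T' u) p q s = hess T p q s + hess T' p q s.
Proof.
rewrite /hess /nabla -(covdD dP); apply: eq_covd => -[|a u] //= _.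
by rewrite (covdD dP).
Qed.

Lemma hessZ p q s c T : (forall p, d p c = 0) ->
  hess (fun u => c * T u) p q s = c * hess T p q s.
Proof.
move=> dc; rewrite /hess /nabla -(covdZ dP) //; apply: eq_covd => -[|a u] //= _.
by rewrite (covdZ dP).
Qed.

Lemma hessN p q s T : hess (fun u => - T u) p q s = - hess T p q s.
Proof.
rewrite /hess /nabla -(covdN dP); apply: eq_covd => -[|a u] //= _.
by rewrite (covdN dP).
Qed.

Lemma hessB p q s T T' :
  hess (fun u => T u - T' u) p q s = hess T p q s - hess T' p q s.
Proof. by rewrite hessD hessN. Qed.

(** A parallel factor, such as the metric, passes through both derivatives. *)
Lemma hess_mul_parallel p q m s X Y : size m = size s ->
  (forall r v, size v = size (mask (map negb m) s) -> covd r v Y = 0) ->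
  hess (fun u => X (mask m u) * Y (mask (map negb m) u)) p q s
  = hess X p q (mask m s) * Y (mask (map negb m) s).
Proof.
move=> sm Y0.
transitivity (covd p (q :: s) (fun u =>
  nabla X (mask (true :: m) u) * Y (mask (map negb (true :: m)) u))).
  apply: eq_covd => -[|a u] //= [us].
  rewrite (covd_mul dP) ?us // [covd _ _ Y]Y0 ?mulr0 ?addr0 //.
  by rewrite !size_mask ?size_map ?us.
by rewrite (covd_mul dP) /= ?sm // Y0 ?mulr0 ?addr0.
Qed.

Lemma covd_mul_parallel p m s X Y : size m = size s ->
  covd p (mask m s) X = 0 -> covd p (mask (map negb m) s) Y = 0 ->
  covd p s (fun u => X (mask m u) * Y (mask (map negb m) u)) = 0.
Proof. by move=> sm X0 Y0; rewrite (covd_mul dP) // X0 Y0 mul0r mulr0 addr0. Qed.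

End SecondDerivatives.

Section HessTrace.
Variables (A : comPzRingType) (n : nat) (d : 'I_n -> A -> A).
Hypothesis dP : forall p, derivation (d p).
Variables (g gi : 'I_n -> 'I_n -> A) (half : A).
Hypothesis halfP : half + half = 1.
Hypothesis gsym : forall i j, g i j = g j i.
Hypothesis gisym : forall i j, gi i j = gi j i.
Hypothesis gV : forall i j, \sum_k gi i k * g k j = (i == j)%:R.
Local Notation tr := (tr gi).
Local Notation Gam := (levi d g gi half).
Local Notation nabla := (nabla d Gam).
Local Notation hess := (hess d Gam).

(** The index of the first derivative must be moved across the traced pair
    before [covd_tr] applies a second time. *)
Lemma hess_tr p q s T :
  hess (fun u => tr (fun a b => T (a :: b :: u))) p q s
  = tr (fun a b => hess T p q (a :: b :: s)).
Proof.
pose T2 u := nabla T (swap_at 0 (swap_at 1 u)).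
transitivity (covd d Gam p (q :: s) (fun u => tr (fun a b => T2 (a :: b :: u)))).
  apply: eq_covd => -[|c u] //= _.
  by rewrite (covd_tr dP halfP gsym gisym gV).
rewrite (covd_tr dP halfP gsym gisym gV); apply: eq_tr => a b.
by rewrite /T2 (covd_swap _ _ _ _ _ (fun u => nabla T (swap_at 0 u))) covd_swap.
Qed.

Definition laplacian T s := tr (fun p q => hess T p q s).

Lemma laplacian_tr s T :
  laplacian (fun u => tr (fun a b => T (a :: b :: u))) s
  = tr (fun a b => laplacian T (a :: b :: s)).
Proof.
rewrite /laplacian tr_exch; apply: eq_tr => p q; exact: hess_tr.
Qed.

End HessTrace.

(** * Algebraic curvature tensors *)

Section CurvatureAlgebra.
Variables (A : comPzRingType) (n : nat).
Variables (gi : 'I_n -> 'I_n -> A) (half : A).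
Hypothesis halfP : half + half = 1.
Hypothesis gisym : forall i j, gi i j = gi j i.
Local Notation tr := (tr gi).

Lemma double_inj (x y : A) : x + x = y + y -> x = y.
Proof.
move=> e; rewrite -[x]mul1r -[y]mul1r -halfP.
by transitivity (half * (x + x)); [ring | rewrite e; ring].
Qed.

Definition alg_curv (R : 'I_n -> 'I_n -> 'I_n -> 'I_n -> A) : Prop :=
  [/\ forall i j k l, R i j k l = - R j i k l,
      forall i j k l, R i j k l = - R i j l k &
      forall i j k l, R i j k l + R j k i l + R k i j l = 0].

Definition ric R (i k : 'I_n) : A := tr (fun j l => R i j k l).

(** For X = Y = R this is the quadratic term B_ijkl of Hamilton; for X = Y
    = W it is D_ijkl. *)
Definition quad X Y (i j k l : 'I_n) : A :=
  tr (fun p q => tr (fun r s => X p i j r * Y s l k q)).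

Definition quad_sum X Y i j k l :=
  quad X Y i j k l - quad X Y i j l k
  + quad X Y i k j l - quad X Y i l j k.

Definition ric_act (h : 'I_n -> 'I_n -> A) T (i j k l : 'I_n) : A :=
  tr (fun p q => h i p * T q j k l + h j p * T i q k l
                 + h k p * T i j q l + h l p * T i j k q).

Variable R : 'I_n -> 'I_n -> 'I_n -> 'I_n -> A.
Hypothesis RP : alg_curv R.
Let R1 i j k l : R i j k l = - R j i k l. Proof. by case: RP. Qed.
Let R2 i j k l : R i j k l = - R i j l k. Proof. by case: RP. Qed.
Let R3 i j k l : R i j k l + R j k i l + R k i j l = 0. Proof. by case: RP. Qed.

(** The octahedron argument: a signed sum of four instances of the cyclic
    identity is twice the difference of the two sides. *)
Lemma alg_curv_pair i j k l : R i j k l = R k l i j.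
Proof.
apply: double_inj; apply/eqP; rewrite -subr_eq0; apply/eqP.
have e1 := R3 i j k l; have e2 := R3 j k l i.
have e3 := R3 k l i j; have e4 := R3 l i j k.
transitivity ((R i j k l + R j k i l + R k i j l)
  + (R j k l i + R k l j i + R l j k i) - (R k l i j + R l i k j + R i k l j)
  - (R l i j k + R i j l k + R j l i k)); last by rewrite e1 e2 e3 e4; ring.
rewrite (R2 j k l i) (R2 k l j i) (R1 l j k i) (R2 l i k j) (R1 i k l j).
rewrite (R2 k i l j) (R2 i j l k) (R2 j l i k); ring.
Qed.
Local Notation Rpair := alg_curv_pair.

Lemma ric_sym i k : ric R i k = ric R k i.
Proof. by rewrite /ric -(tr_swap gisym); apply: eq_tr => j l; rewrite Rpair. Qed.

Lemma tr14 j k : tr (fun a b => R a j k b) = - ric R j k.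
Proof. by rewrite -trN; apply: eq_tr => a b; rewrite R1. Qed.

Lemma tr13 j l : tr (fun a b => R a j b l) = ric R j l.
Proof. by apply: eq_tr => a b; rewrite R1 R2 opprK. Qed.

Lemma tr23 j l : tr (fun a b => R j a b l) = - ric R j l.
Proof. by rewrite -trN; apply: eq_tr => a b; rewrite R2. Qed.

End CurvatureAlgebra.

Lemma quad_swap (A : comPzRingType) n (gi : 'I_n -> 'I_n -> A) (half : A)
    (halfP : half + half = 1) (gisym : forall i j, gi i j = gi j i)
    (X Y : 'I_n -> 'I_n -> 'I_n -> 'I_n -> A) (XP : alg_curv X) (YP : alg_curv Y)
    i j k l :
  quad gi X Y i j k l = quad gi Y X k l i j.
Proof.
have [X1 X2 _] := XP; have [Y1 Y2 _] := YP.
have Xp := alg_curv_pair halfP XP; have Yp := alg_curv_pair halfP YP.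
rewrite /quad -(tr_swap gisym); apply: eq_tr => p q.
rewrite -(tr_swap gisym); apply: eq_tr => r s.
rewrite mulrC (Xp q) (X1 j) (X2 _ _ _ i) opprK.
by rewrite (Yp r) (Y1 k) (Y2 _ _ _ l) opprK.
Qed.

(** * The Laplacian of the curvature *)

Section LaplacianOfCurvature.
Variables (A : comPzRingType) (n : nat) (d : 'I_n -> A -> A).
Hypothesis dP : forall p, derivation (d p).
Hypothesis dC : forall p q x, d p (d q x) = d q (d p x).
Variables (g gi : 'I_n -> 'I_n -> A) (half : A).
Hypothesis halfP : half + half = 1.
Hypothesis gsym : forall i j, g i j = g j i.
Hypothesis gisym : forall i j, gi i j = gi j i.
Hypothesis gV : forall i j, \sum_k gi i k * g k j = (i == j)%:R.
Local Notation tr := (tr gi).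
Local Notation Gam := (levi d g gi half).
Local Notation covd := (covd d Gam).
Local Notation nabla := (nabla d Gam).
Local Notation hess := (hess d Gam).
Local Notation lap := (laplacian d g gi half).
Local Notation R := (riemann d g gi half).
Local Notation Ric := (ric gi R).
Local Notation tR := (tens4 R).
Local Notation tRic := (tens2 Ric).

Lemma riemann_alg : alg_curv R.
Proof.
split=> i j k l.
- exact: riemann_anti1.
- exact: (riemann_anti2 dP dC halfP gsym gisym gV).
- exact: (riemann_bianchi1 _ _ _ gsym).
Qed.

Let RP := riemann_alg.
Let R1 i j k l : R i j k l = - R j i k l. Proof. by case: RP. Qed.
Let R2 i j k l : R i j k l = - R i j l k. Proof. by case: RP. Qed.
Let R3 i j k l : R i j k l + R j k i l + R k i j l = 0. Proof. by case: RP. Qed.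
Let Rpair i j k l : R i j k l = R k l i j.
Proof. exact: (alg_curv_pair halfP RP). Qed.

Lemma nabla_R1 p i j k l : nabla tR [:: p; i; j; k; l] = - nabla tR [:: p; j; i; k; l].
Proof.
transitivity (- covd p [:: i; j; k; l] (fun u => tR (swap_at 0 u))); last by rewrite covd_swap.
rewrite -(covdN dP).
by apply: eq_covd => -[|a[|b[|c[|e[|? ?]]]]] //= _; exact: R1.
Qed.

Lemma nabla_R2 p i j k l : nabla tR [:: p; i; j; k; l] = - nabla tR [:: p; i; j; l; k].
Proof.
transitivity (- covd p [:: i; j; k; l] (fun u => tR (swap_at 2 u))); last by rewrite covd_swap.
rewrite -(covdN dP).
by apply: eq_covd => -[|a[|b[|c[|e[|? ?]]]]] //= _; exact: R2.
Qed.

Lemma nabla_Rpair p i j k l : nabla tR [:: p; i; j; k; l] = nabla tR [:: p; k; l; i; j].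
Proof.
pose sw (T : seq 'I_n -> A) m u := T (swap_at m u).
transitivity (covd p [:: i; j; k; l] (sw (sw (sw (sw tR 1%N) 2%N) 0%N) 1%N)).
  by apply: eq_covd => -[|a[|b[|c[|e[|? ?]]]]] //= _; exact: Rpair.
by rewrite 4!covd_swap.
Qed.

Lemma nabla_tr (T : seq 'I_n -> A) p s :
  nabla (fun u => tr (fun a b => T (a :: b :: u))) (p :: s) =
  tr (fun a b => nabla T (p :: a :: b :: s)).
Proof. exact: (covd_tr dP halfP gsym gisym gV). Qed.

Lemma nabla_Ric p i k :
  nabla tRic [:: p; i; k] = tr (fun a b => nabla tR [:: p; a; i; b; k]).
Proof.
pose sw (T : seq 'I_n -> A) m u := T (swap_at m u).
transitivity (nabla (fun u => tr (fun a b => sw tR 1%N (a :: b :: u))) [:: p; i; k]).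
  apply: eq_covd => -[|a[|b[|? ?]]] //= _.
  by rewrite -(tr13 _ RP).
rewrite nabla_tr; apply: eq_tr => a b.
exact: (covd_swap d Gam p 1 [:: a; b; i; k] tR).
Qed.

(** The contracted second Bianchi identity. *)
Lemma divergence_R j k l :
  tr (fun a b => nabla tR [:: a; j; b; k; l])
  = nabla tRic [:: l; k; j] - nabla tRic [:: k; l; j].
Proof.
rewrite !nabla_Ric -trB; apply: eq_tr => a b.
have := riemann_bianchi2 dP dC halfP gsym gisym gV a k l j b.
rewrite -/(nabla tR [:: a; k; l; j; b]) -/(nabla tR [:: k; l; a; j; b]).
rewrite -/(nabla tR [:: l; a; k; j; b]) => e.
rewrite nabla_Rpair (nabla_R2 k) (nabla_R2 l) (nabla_R1 k) -[LHS]subr0 -e; ring.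
Qed.

Lemma hess_Ric_sym p q i j : hess tRic p q [:: i; j] = hess tRic p q [:: j; i].
Proof.
rewrite -[[:: j; i]]/(swap_at 0 [:: i; j]) -hess_swap; apply: eq_hess.
by case=> [|a[|b[|? ?]]] //= _; rewrite (ric_sym halfP gisym RP).
Qed.

(** The second derivatives of Ric that occur both in the Laplacian and in
    the time derivative of the curvature, and therefore drop out of the
    evolution equation. *)
Definition ric_hess_terms i j k l := hess tRic i k [:: j; l] - hess tRic i l [:: j; k]
  - hess tRic j k [:: i; l] + hess tRic j l [:: i; k].

Lemma trace_hess_R i j k l :
  tr (fun a b => hess tR i a [:: j; b; k; l])
  = hess tRic i l [:: j; k] - hess tRic i k [:: j; l].
Proof.
pose sw (T : seq 'I_n -> A) m u := T (swap_at m u).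
transitivity (nabla (fun u => tr (fun a b => sw (nabla tR) 1%N (a :: b :: u))) [:: i; j; k; l]).
  rewrite nabla_tr; apply: eq_tr => a b; symmetry.
  exact: (covd_swap d Gam i 1 [:: a; b; j; k; l] (nabla tR)).
transitivity (nabla (fun u => sw (sw (sw (nabla tRic) 0%N) 1%N) 0%N u - sw (sw (nabla tRic) 1%N) 0%N u) [:: i; j; k; l]).
  apply: eq_covd => -[|a[|b[|c[|? ?]]]] // _.
  exact: divergence_R.
rewrite /nabla (covdB dP) 5!covd_swap.
change (hess tRic i l [:: k; j] - hess tRic i k [:: l; j] = hess tRic i l [:: j; k] - hess tRic i k [:: j; l]).
by rewrite (hess_Ric_sym i l) (hess_Ric_sym i k).
Qed.

(** What is created when, in the second derivatives of R, the derivative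
    that is contracted into a divergence is exchanged with the other one. *)
Definition traced_commutator i j k l := tr (fun a b => curv_act d Gam a i [:: j; b; k; l] tR).

(** The second Bianchi identity expresses the Laplacian by derivatives
    contracted with the curvature; once the two derivatives are exchanged,
    divergences of R appear, that is, derivatives of Ric. *)
Lemma laplacian_R i j k l :
  lap tR [:: i; j; k; l] = ric_hess_terms i j k l - traced_commutator i j k l + traced_commutator j i k l.
Proof.
have Bi a b : hess tR a b [:: i; j; k; l] =
    - hess tR a i [:: j; b; k; l] + hess tR a j [:: i; b; k; l].
  pose sw (T : seq 'I_n -> A) m u := T (swap_at m u).
  have e : covd a [:: b; i; j; k; l] (fun u =>
     nabla tR u + sw (sw (nabla tR) 1%N) 0%N u + sw (sw (nabla tR) 0%N) 1%N u) = 0.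
    rewrite -[RHS](covd0 dP Gam a [:: b; i; j; k; l]); apply: eq_covd.
    case=> [|b'[|i'[|j'[|k'[|l'[|? ?]]]]]] // _.
    exact: (riemann_bianchi2 dP dC halfP gsym gisym gV).
  move/eqP: e; rewrite !(covdD dP) 4!covd_swap /= -addrA addr_eq0 => /eqP e.
  rewrite [LHS]e opprD; congr (_ + _).
  transitivity (- covd a [:: j; i; b; k; l] (sw (nabla tR) 1%N)).
    by rewrite covd_swap.
  rewrite -(covdN dP).
  apply: eq_covd => -[|b'[|i'[|j'[|k'[|l'[|? ?]]]]]] // _.
  by rewrite /sw [swap_at _ _]/= nabla_R1 opprK.
rewrite /laplacian (eq_tr gi Bi) trD trN.
have C x y : tr (fun a b => hess tR a x [:: y; b; k; l]) =
   tr (fun a b => hess tR x a [:: y; b; k; l]) + traced_commutator x y k l.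
  rewrite -trD; apply: eq_tr => a b; rewrite /hess.
  by rewrite -(nabla2_comm dP dC (levi_sym d gi half gsym)); ring.
rewrite !C !trace_hess_R /ric_hess_terms; ring.
Qed.

Lemma traced_commutatorE i j k l :
  traced_commutator i j k l = quad gi R R i k j l - quad gi R R i l j k
   + (quad gi R R i j k l - quad gi R R i j l k)
   + tr (fun o c => Ric i c * R j o k l).
Proof.
rewrite /traced_commutator.
have ca a b : curv_act d Gam a i [:: j; b; k; l] tR =
  tr (fun o c => R a i l c * R j b k o) + tr (fun o c => R a i k c * R j b o l)
  + tr (fun o c => R a i b c * R j o k l) + tr (fun o c => R a i j c * R o b k l).
  by rewrite /= !(curv_sumE _ _ gV) add0r.
have h1 : tr (fun a b => tr (fun o c => R a i l c * R j b k o))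
          = - quad gi R R i l j k.
  rewrite /quad -trN; apply: eq_tr => a b; rewrite -trN -(tr_swap gisym).
  by apply: eq_tr => c o; rewrite (Rpair o k) (R2 j b o) mulrN opprK.
have h2 : tr (fun a b => tr (fun o c => R a i k c * R j b o l))
          = quad gi R R i k j l.
  rewrite /quad; apply: eq_tr => a b; rewrite -(tr_swap gisym).
  by apply: eq_tr => c o; rewrite (Rpair o l).
have h3 : tr (fun a b => tr (fun o c => R a i b c * R j o k l))
          = tr (fun o c => Ric i c * R j o k l).
  rewrite tr_exch; apply: eq_tr => o c.
  rewrite trZr; congr (_ * _).
  by apply: eq_tr => a b; rewrite R1 R2 opprK.
(* the only term that needs the first Bianchi identity *)
have h4 : tr (fun a b => tr (fun o c => R a i j c * R o b k l))
          = quad gi R R i j k l - quad gi R R i j l k.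
  rewrite /quad -trB; apply: eq_tr => a b; rewrite -trB -(tr_swap gisym).
  apply: eq_tr => c o; rewrite -mulrBr; congr (_ * _).
  have := R3 o l k b; rewrite (R1 k o) => e.
  rewrite -[LHS]addr0 -e (R1 l k) (Rpair k l); ring.
rewrite (eq_tr gi ca) !trD h1 h2 h3 h4; ring.
Qed.

Lemma laplacian_riemann i j k l :
  lap tR [:: i; j; k; l] = ric_hess_terms i j k l
   - (quad_sum gi R R i j k l + quad_sum gi R R i j k l)
   + tr (fun p q => Ric i p * R q j k l + Ric j p * R i q k l).
Proof.
rewrite laplacian_R !traced_commutatorE.
have sw := quad_swap halfP gisym RP RP.
have jl x y z w : quad gi R R x y z w = quad gi R R y x w z.
  rewrite /quad tr_exch; apply: eq_tr => p q; apply: eq_tr => r s.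
  rewrite (Rpair r x y p) (R1 y p) (R2 p y) opprK.
  by rewrite (Rpair q w z s) (R1 z s) (R2 s z) opprK.
rewrite (jl j i k l) (jl j i l k) (sw j k i l) (sw j l i k) /quad_sum trD.
have -> : tr (fun p q => Ric i p * R q j k l) = - tr (fun o c => Ric i c * R j o k l).
  by rewrite -trN -(tr_swap gisym); apply: eq_tr => a b; rewrite R1 mulrN.
have -> : tr (fun p q => Ric j p * R i q k l) = tr (fun o c => Ric j c * R i o k l).
  by rewrite -(tr_swap gisym).
ring.
Qed.

End LaplacianOfCurvature.

(** * Evolution of the curvature under the flow *)

Section Evolution.
Variables (A : comPzRingType) (n : nat) (d : 'I_n -> A -> A).
Hypothesis dP : forall p, derivation (d p).
Hypothesis dC : forall p q x, d p (d q x) = d q (d p x).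
Variables (g gi : 'I_n -> 'I_n -> A) (half : A).
Hypothesis halfP : half + half = 1.
Hypothesis gsym : forall i j, g i j = g j i.
Hypothesis gisym : forall i j, gi i j = gi j i.
Hypothesis gV : forall i j, \sum_k gi i k * g k j = (i == j)%:R.
Local Notation tr := (tr gi).
Local Notation Gam := (levi d g gi half).
Local Notation covd := (covd d Gam).
Local Notation nabla := (nabla d Gam).
Local Notation hess := (hess d Gam).
Local Notation lap := (laplacian d g gi half).
Local Notation curv := (curv d Gam).
Local Notation R := (riemann d g gi half).
Local Notation Ric := (ric gi R).
Local Notation tR := (tens4 R).
Local Notation tRic := (tens2 Ric).
Local Notation Z := (ric_hess_terms d g gi half).

Let RP := riemann_alg dP dC halfP gsym gisym gV.
Let R1 i j k l : R i j k l = - R j i k l. Proof. by case: RP. Qed.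
Let R2 i j k l : R i j k l = - R i j l k. Proof. by case: RP. Qed.
Let R3 i j k l : R i j k l + R j k i l + R k i j l = 0. Proof. by case: RP. Qed.
Let Rpair i j k l : R i j k l = R k l i j.
Proof. exact: (alg_curv_pair halfP RP). Qed.
Let Ricsym i k : Ric i k = Ric k i.
Proof. exact: (ric_sym halfP gisym RP). Qed.

Variable dt : A -> A.
Hypothesis dtP : derivation dt.
Hypothesis dtC : forall p x, dt (d p x) = d p (dt x).
Hypothesis flow : forall i j, dt (g i j) = - (Ric i j + Ric i j).

Let C p i m := dt (Gam p i m).
Let Clow p i l := \sum_m g l m * C p i m.
Let dRic p i l := nabla tRic [:: p; i; l].

Lemma dt_half : dt half = 0.
Proof.
apply: (der_inverse_const dtP (u := 2%:R)); last exact: der_nat.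
by rewrite mulr_natr mulr2n.
Qed.

(** Differentiate the formula 2 g_lm Gam^m_pi = d_p g_il + d_i g_pl - d_l
    g_pi in time. The variation of a connection is a tensor: the terms
    coming from the time derivative of g_lm are exactly those that turn the
    partial derivatives of Ric into covariant ones. *)
Lemma dt_levi p i l :
  Clow p i l = - (dRic p i l + dRic i p l - dRic l p i).
Proof.
have e : \sum_m dt (g l m) * Gam p i m + Clow p i l =
         - (d p (Ric i l) + d i (Ric p l) - d l (Ric p i)).
  rewrite /Clow -big_split /=.
  under eq_bigr do rewrite -(derM dtP).
  rewrite -(der_sum dtP) (levi_lower d half gsym gisym gV) (derM dtP) dt_half mul0r add0r.
  rewrite (derB dtP) (derD dtP) !dtC !flow !(derN (dP _)) !(derD (dP _)).
  rewrite -[RHS]mulN1r -halfP; ring.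
rewrite -[LHS](addKr (\sum_m dt (g l m) * Gam p i m)) e.
have -> : \sum_m dt (g l m) * Gam p i m =
    - (\sum_m Gam p i m * Ric m l + \sum_m Gam p i m * Ric m l).
  rewrite -big_split -sumrN; apply: eq_bigr => m _ /=.
  by rewrite flow (Ricsym l); ring.
rewrite /dRic /=.
have -> : \sum_m Gam i l m * Ric p m = \sum_m Gam l i m * Ric p m.
  by apply: eq_bigr => m _; rewrite (levi_sym d gi half gsym).
have -> : \sum_m Gam i p m * Ric m l = \sum_m Gam p i m * Ric m l.
  by apply: eq_bigr => m _; rewrite (levi_sym d gi half gsym).
have -> : \sum_m Gam p l m * Ric i m = \sum_m Gam l p m * Ric m i.
  by apply: eq_bigr => m _; rewrite (levi_sym d gi half gsym) Ricsym.
ring.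
Qed.

Definition tens3 (f : 'I_n -> 'I_n -> 'I_n -> A) : seq 'I_n -> A :=
  fun s => if s is [:: i; j; k] then f i j k else 0.

(** The variation of the curvature is the antisymmetrised covariant
    derivative of the variation of the connection. The identity X treats
    one half of the antisymmetrisation; its last term is symmetric in p and
    q. *)
Lemma dt_curv_lower p q i l :
  \sum_o g l o * dt (curv p q i o) =
  covd q [:: p; i; l] (tens3 Clow) - covd p [:: q; i; l] (tens3 Clow).
Proof.
have X p' q' : \sum_o g l o * (d q' (C p' i o) + \sum_m C p' i m * Gam q' m o
                 - \sum_m Gam q' i m * C p' m o) =
   covd q' [:: p'; i; l] (tens3 Clow) + \sum_m Gam q' p' m * Clow m i l.
  under eq_bigr do rewrite mulrBr mulrDr.
  rewrite sumrB big_split /=.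
  have -> : d q' (Clow p' i l) = \sum_o d q' (g l o) * C p' i o + \sum_o g l o * d q' (C p' i o).
    rewrite (der_sum (dP q')) -big_split; apply: eq_bigr => o _ /=.
    by rewrite (derM (dP q')).
  have -> : \sum_o d q' (g l o) * C p' i o =
     \sum_m Gam q' l m * Clow p' i m + \sum_o g l o * \sum_m C p' i m * Gam q' m o.
    under eq_bigr do rewrite (metric_compatible d halfP gsym gisym gV) mulrDl.
    rewrite big_split /=; congr (_ + _).
      under [RHS]eq_bigr do rewrite big_distrr /=.
      rewrite exchange_big; apply: eq_bigr => o _ /=; rewrite big_distrl.
      by apply: eq_bigr => m _ /=; ring.
    under [RHS]eq_bigr do rewrite big_distrr /=.
    rewrite exchange_big; apply: eq_bigr => o _ /=; rewrite big_distrl.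
    by apply: eq_bigr => m _ /=; ring.
  have -> : \sum_o g l o * (\sum_m Gam q' i m * C p' m o) = \sum_m Gam q' i m * Clow p' m l.
    under eq_bigr do rewrite big_distrr /=.
    rewrite exchange_big; apply: eq_bigr => o _ /=; rewrite big_distrr.
    by apply: eq_bigr => m _ /=; ring.
  ring.
have e : \sum_o g l o * dt (curv p q i o) =
  \sum_o g l o * (d q (C p i o) + \sum_m C p i m * Gam q m o
                 - \sum_m Gam q i m * C p m o)
  - \sum_o g l o * (d p (C q i o) + \sum_m C q i m * Gam p m o
                 - \sum_m Gam p i m * C q m o).
  rewrite -sumrB; apply: eq_bigr => o _; rewrite -mulrBr; congr (_ * _).
  rewrite (derD dtP) (derB dtP) !dtC (der_sum dtP).
  rewrite -/(C p i o) -/(C q i o).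
  have -> : \sum_m dt (Gam p i m * Gam q m o - Gam q i m * Gam p m o) =
     \sum_m C p i m * Gam q m o + \sum_m Gam p i m * C q m o
     - (\sum_m C q i m * Gam p m o + \sum_m Gam q i m * C p m o).
    rewrite -!big_split -sumrB; apply: eq_bigr => m _ /=.
    by rewrite (derB dtP) (derM dtP (Gam p i m)) (derM dtP (Gam q i m)) /C; ring.
  ring.
rewrite e !X.
have -> : \sum_m Gam q p m * Clow m i l = \sum_m Gam p q m * Clow m i l.
  by apply: eq_bigr => m _; rewrite (levi_sym d gi half gsym).
ring.
Qed.

Lemma covd_Clow p q i l : covd q [:: p; i; l] (tens3 Clow) =
  - (hess tRic q p [:: i; l] + hess tRic q i [:: p; l] - hess tRic q l [:: p; i]).
Proof.
pose sw (T : seq 'I_n -> A) m u := T (swap_at m u).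
transitivity (covd q [:: p; i; l] (fun u => - (nabla tRic u + sw (nabla tRic) 0%N u
   - sw (sw (nabla tRic) 0%N) 1%N u))).
  apply: eq_covd => -[|a[|b[|c[|? ?]]]] // _; exact: dt_levi.
by rewrite (covdN dP) (covdB dP) (covdD dP) 3!covd_swap.
Qed.

(** Two of the six second derivatives of Ric given by [dt_curv_lower] and
    [dt_levi] form a commutator, which the Ricci identity turns into
    curvature terms; they combine with the term coming from the time
    derivative of the metric that lowers the index. *)
Lemma dt_riemann i j k l :
  dt (R i j k l) = Z i j k l - tr (fun p q => Ric k p * R i j q l + Ric l p * R i j k q).
Proof.
have -> : dt (R i j k l) = \sum_o dt (g l o) * curv i j k o + \sum_o g l o * dt (curv i j k o).
  rewrite (der_sum dtP) -big_split; apply: eq_bigr => o _ /=.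
  by rewrite (derM dtP).
rewrite dt_curv_lower !covd_Clow trD.
(* the commutator of the two derivatives of Ric in the form indices *)
have c : hess tRic i j [:: k; l] = hess tRic j i [:: k; l]
  + (tr (fun p q => Ric l p * R i j k q) - tr (fun p q => Ric k p * R i j q l)).
  have := nabla2_comm dP dC (levi_sym d gi half gsym) i j [:: k; l] tRic.
  rewrite -!/(hess _ _ _ _) => /eqP; rewrite subr_eq addrC => /eqP ->.
  congr (_ + _); rewrite /= add0r !(curv_sumE _ _ gV) addrC; congr (_ + _).
    by apply: eq_tr => a b; rewrite (Ricsym _ l) mulrC.
  rewrite -trN; apply: eq_tr => a b.
  by rewrite R2 mulrC mulrN.
rewrite c.
have -> : \sum_o dt (g l o) * curv i j k o =
   - (tr (fun p q => Ric l p * R i j k q) + tr (fun p q => Ric l p * R i j k q)).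
  have e : \sum_o curv i j k o * dt (g l o) =
    tr (fun p q => R i j k q * dt (g l p)) by rewrite (curv_sumE _ _ gV).
  under eq_bigr do rewrite mulrC.
  rewrite e -trD -trN; apply: eq_tr => a b.
  by rewrite flow; ring.
rewrite /ric_hess_terms; ring.
Qed.

(** The reaction-diffusion equation of the curvature: the second
    derivatives of Ric in [dt_riemann] and [laplacian_riemann] are the
    same. *)
Lemma riemann_evolution i j k l :
  dt (R i j k l) - lap tR [:: i; j; k; l] =
  quad_sum gi R R i j k l + quad_sum gi R R i j k l - ric_act gi Ric R i j k l.
Proof.
rewrite dt_riemann (laplacian_riemann dP dC halfP gsym gisym gV) /ric_act !trD.
ring.
Qed.

(** The inverse metric evolves by twice the Ricci tensor with raised
    indices. *)
Lemma dt_tr f : dt (tr f) = tr (fun a b => dt (f a b))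
  + (tr (fun a b => tr (fun c e => Ric a c * f b e))
  + tr (fun a b => tr (fun c e => Ric a c * f b e))).
Proof.
have -> : dt (tr f) = \sum_a \sum_b dt (gi a b) * f a b + tr (fun a b => dt (f a b)).
  rewrite (der_sum dtP) -big_split; apply: eq_bigr => a _ /=.
  rewrite (der_sum dtP) -big_split; apply: eq_bigr => b _ /=.
  by rewrite (derM dtP).
rewrite addrC; congr (_ + _).
have e a b : dt (gi a b) = \sum_k \sum_l gi a k * gi l b * (Ric k l + Ric k l).
  rewrite (derivation_inverse gsym gisym gV _ _ dtP) -sumrN; apply: eq_bigr => k _.
  by rewrite -sumrN; apply: eq_bigr => l _; rewrite flow; ring.
rewrite -trD.
transitivity (\sum_a \sum_b \sum_k \sum_l
   gi a k * (gi l b * ((Ric k l + Ric k l) * f a b))).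
  apply: eq_bigr => a _; apply: eq_bigr => b _; rewrite e big_distrl.
  apply: eq_bigr => k _ /=; rewrite big_distrl; apply: eq_bigr => l _ /=; ring.
transitivity (\sum_a \sum_k gi a k * tr (fun l b => (Ric k l + Ric k l) * f a b)).
  apply: eq_bigr => a _; rewrite exchange_big; apply: eq_bigr => k _ /=.
  rewrite exchange_big big_distrr; apply: eq_bigr => l _ /=.
  by rewrite big_distrr; apply: eq_bigr => b _ /=.
rewrite -[RHS](tr_swap gisym); apply: eq_tr => a k.
rewrite -trD; apply: eq_tr => l b; ring.
Qed.

Lemma laplacian_Ric i k :
  lap tRic [:: i; k] = tr (fun j l => lap tR [:: i; j; k; l]).
Proof.
pose sw (T : seq 'I_n -> A) m u := T (swap_at m u).
pose T := sw (sw (sw tR 2%N) 0%N) 1%N.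
transitivity (lap (fun u => tr (fun a b => T (a :: b :: u))) [:: i; k]).
  by apply: eq_tr => p q; apply: eq_hess => -[|a[|b[|? ?]]] // _.
rewrite (laplacian_tr dP halfP gsym gisym gV); apply: eq_tr => a b.
by apply: eq_tr => p q; rewrite /T 3!hess_swap.
Qed.

Lemma hess_scal p q :
  hess (tens0 (tr Ric)) p q [::] = tr (fun a b => hess tRic p q [:: a; b]).
Proof.
rewrite -(hess_tr dP halfP gsym gisym gV).
by apply: eq_hess => -[].
Qed.

Lemma laplacian_scal :
  lap (tens0 (tr Ric)) [::] = tr (fun i k => lap tRic [:: i; k]).
Proof.
by rewrite /laplacian tr_exch; apply: eq_tr => p q; apply: hess_scal.
Qed.

Lemma ric_evolution i k :
  dt (Ric i k) - lap tRic [:: i; k] =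
  tr (fun j l => quad_sum gi R R i j k l + quad_sum gi R R i j k l - ric_act gi Ric R i j k l)
  + (tr (fun a b => tr (fun c e => Ric a c * R i b k e))
     + tr (fun a b => tr (fun c e => Ric a c * R i b k e))).
Proof.
rewrite dt_tr laplacian_Ric addrAC -trB; congr (_ + _).
by apply: eq_tr => j l; rewrite riemann_evolution.
Qed.

Lemma scal_evolution :
  dt (tr Ric) - lap (tens0 (tr Ric)) [::] =
  tr (fun i k => dt (Ric i k) - lap tRic [:: i; k])
  + (tr (fun a b => tr (fun c e => Ric a c * Ric b e))
     + tr (fun a b => tr (fun c e => Ric a c * Ric b e))).
Proof. by rewrite dt_tr laplacian_scal addrAC -trB. Qed.

End Evolution.

(** * Quadratic contractions of curvature tensors *)

Section TraceOfQuadratic.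
Variables (A : comPzRingType) (n : nat) (gi : 'I_n -> 'I_n -> A) (half : A).
Hypothesis halfP : half + half = 1.
Hypothesis gisym : forall i j, gi i j = gi j i.
Local Notation tr := (tr gi).
Variable R : 'I_n -> 'I_n -> 'I_n -> 'I_n -> A.
Hypothesis RP : alg_curv R.
Let R1 i j k l : R i j k l = - R j i k l. Proof. by case: RP. Qed.
Let R2 i j k l : R i j k l = - R i j l k. Proof. by case: RP. Qed.
Let R3 i j k l : R i j k l + R j k i l + R k i j l = 0. Proof. by case: RP. Qed.
Let Rpair i j k l : R i j k l = R k l i j.
Proof. exact: (alg_curv_pair halfP RP). Qed.
Local Notation Ric := (ric gi R).
Let Ricsym i k : Ric i k = Ric k i.
Proof. exact: (ric_sym halfP gisym RP). Qed.

Definition curv_apply (h : 'I_n -> 'I_n -> A) T (i k : 'I_n) : A :=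
  tr (fun a b => tr (fun c e => h a c * T i b k e)).
Definition prod2 (h h' : 'I_n -> 'I_n -> A) (i k : 'I_n) : A :=
  tr (fun p q => h i p * h' q k).
Definition inner2 (h h' : 'I_n -> 'I_n -> A) : A :=
  tr (fun a b => tr (fun c e => h a c * h' b e)).

(** With U the trace of the second term, the first one has trace U + U by
    the first Bianchi identity and the fourth one has trace U; these three
    cancel, and the third term gives the curvature applied to Ric. *)
Lemma trace_quad_sum i k : tr (fun j l => quad_sum gi R R i j k l) = curv_apply Ric R i k.
Proof.
rewrite /quad_sum trB trD trB.
have T3 : tr (fun j l => quad gi R R i k j l) = curv_apply Ric R i k.
  rewrite /quad tr_exch /curv_apply -[RHS](tr_swap gisym); apply: eq_tr => p q.
  rewrite tr_exch -[RHS](tr_swap gisym); apply: eq_tr => r s.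
  rewrite trZ -(tr_swap gisym) (tr23 gi RP) R1 mulrNN mulrC.
  by rewrite (Ricsym s q).
pose U := tr (fun j l => tr (fun p q => tr (fun r s => R p i j r * R s k l q))).
have T2 : tr (fun j l => quad gi R R i j l k) = U by [].
have T4 : tr (fun j l => quad gi R R i l j k) = U.
  by rewrite -(tr_swap gisym).
have U' : U = - tr (fun j l => tr (fun p q => tr (fun r s => R p i j r * R l k s q))).
  rewrite /U -trN tr_exch; under [RHS]eq_tr do rewrite -trN.
  rewrite [RHS]tr_exch; apply: eq_tr => p q; rewrite tr_exch.
  apply: eq_tr => j l; rewrite -trN; apply: eq_tr => r s.
  by rewrite R2 mulNr.
have T1 : tr (fun j l => quad gi R R i j k l) = U + U.
  rewrite {2}U' -trB; apply: eq_tr => j l; rewrite -trB; apply: eq_tr => p q.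
  rewrite -trB; apply: eq_tr => r s; rewrite -mulrBr; congr (_ * _).
  by have := R3 l s k q; rewrite (R1 l s) (R1 k l) => e; rewrite -[LHS]addr0 -e; ring.
rewrite T1 T2 T3 T4; ring.
Qed.

Lemma trace_ric_act i k : tr (fun j l => ric_act gi Ric R i j k l) =
  prod2 Ric Ric i k + prod2 Ric Ric i k + (curv_apply Ric R i k + curv_apply Ric R i k).
Proof.
rewrite /ric_act; under eq_tr do rewrite !trD.
rewrite !trD.
have -> : tr (fun j l => tr (fun p q => Ric i p * R q j k l)) = prod2 Ric Ric i k.
  by rewrite tr_exch; apply: eq_tr => p q; rewrite trZ.
have -> : tr (fun j l => tr (fun p q => Ric k p * R i j q l)) = prod2 Ric Ric i k.
  rewrite tr_exch /prod2 -[RHS](tr_swap gisym); apply: eq_tr => p q.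
  by rewrite trZ mulrC (Ricsym k).
have -> : tr (fun j l => tr (fun p q => Ric j p * R i q k l)) = curv_apply Ric R i k.
  rewrite tr_exch; apply: eq_tr => p q; apply: eq_tr => j l.
  by rewrite (Ricsym j).
have -> : tr (fun j l => tr (fun p q => Ric l p * R i j k q)) = curv_apply Ric R i k.
  by rewrite -(tr_swap gisym).
ring.
Qed.

Lemma trace_curv_apply : tr (curv_apply Ric R) = inner2 Ric Ric.
Proof.
rewrite /curv_apply /inner2 tr_exch; apply: eq_tr => a b; rewrite tr_exch.
by apply: eq_tr => c e; rewrite trZ (tr13 gi RP).
Qed.

Lemma trace_prod2 : tr (prod2 Ric Ric) = inner2 Ric Ric.
Proof.
rewrite /prod2 /inner2; apply: eq_tr => a b; apply: eq_tr => c e.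
by rewrite (Ricsym e).
Qed.

End TraceOfQuadratic.

Section WeylAlgebra.
Variables (A : comPzRingType) (n : nat).
Variables (g gi : 'I_n -> 'I_n -> A) (half : A).
Hypothesis halfP : half + half = 1.
Hypothesis gsym : forall i j, g i j = g j i.
Hypothesis gisym : forall i j, gi i j = gi j i.
Hypothesis gV : forall i j, \sum_k gi i k * g k j = (i == j)%:R.
Local Notation tr := (tr gi).
Local Notation trg := (tr_g gsym gisym gV).
Local Notation trgl := (tr_gl gsym gisym gV).
Local Notation trgr := (tr_gr gsym gisym gV).

Lemma tr_grl i v : tr (fun a b => v a * g i b) = v i.
Proof. by rewrite -[RHS](trgr i v); apply: eq_tr => a b; rewrite (gsym i). Qed.

Lemma tr_gC1 i v : tr (fun a b => v b * g a i) = v i.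
Proof. by rewrite -[RHS](trgl i v); apply: eq_tr => a b; rewrite mulrC. Qed.
Lemma tr_gC2 i v : tr (fun a b => v b * g i a) = v i.
Proof. by rewrite -[RHS](trg i v); apply: eq_tr => a b; rewrite mulrC. Qed.
Lemma tr_gC3 i v : tr (fun a b => g b i * v a) = v i.
Proof. by rewrite -[RHS](trgr i v); apply: eq_tr => a b; rewrite mulrC. Qed.
Lemma tr_gC4 i v : tr (fun a b => g i b * v a) = v i.
Proof. by rewrite -[RHS](tr_grl i v); apply: eq_tr => a b; rewrite mulrC. Qed.
(** Contracting a slot with the metric renames an index; the eight
    equations are the places where the metric factor can stand. *)
Definition trgE := (trg, trgl, trgr, tr_grl, tr_gC1, tr_gC2, tr_gC3, tr_gC4).

(** The Kulkarni-Nomizu product of two symmetric tensors. *)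
Definition kn (h k' : 'I_n -> 'I_n -> A) i j k l : A :=
  h i k * k' j l - h i l * k' j k + h j l * k' i k - h j k * k' i l.

Section General.
Variable h : 'I_n -> 'I_n -> A.
Hypothesis hsym : forall i j, h i j = h j i.
Local Notation K := (kn h g).

Lemma kn_alg : alg_curv K.
Proof.
split=> i j k l; rewrite /kn; first by ring.
  by ring.
rewrite (hsym j i) (hsym k j) (hsym k i) (gsym j i) (gsym k j) (gsym k i).
by ring.
Qed.

Lemma ric_kn i k : ric gi K i k = h i k * (n%:R - 2) + tr h * g i k.
Proof.
rewrite /ric /kn trB trD trB trZ trZr (tr_gg gsym gV) tr_grl.
have -> : tr (fun a b => h i b * g a k) = h i k.
  by rewrite -[RHS](trgl k (h i)); apply: eq_tr => a b; rewrite mulrC.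
ring.
Qed.

Local Notation h2 := (prod2 gi h h).
Local Notation hh := (inner2 gi h h).

Lemma prod2_sym i k : h2 i k = h2 k i.
Proof.
rewrite /prod2 -(tr_swap gisym); apply: eq_tr => a b.
by rewrite mulrC (hsym i) (hsym a).
Qed.

(** Each of the four summands of h /\ g contains the metric, which renames
    an index of M or takes its trace. All the quadratic terms involving h
    /\ g reduce to this one. *)
Lemma tr_tr_kn (M : 'I_n -> 'I_n -> A) l k :
  tr (fun p q => tr (fun r s => M p r * K s l k q)) =
  tr (fun r s => M l r * h s k) - g l k * inner2 gi M h
  + tr (fun p q => M p k * h q l) - h l k * tr M.
Proof.
have e p q : tr (fun r s => M p r * K s l k q) =
    tr (fun r s => M p r * h s k) * g l q
    - g l k * tr (fun r s => M p r * h s q)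
    + M p k * h q l - h l k * M p q.
  rewrite -trZr -trZ -(trgE.1.2 k (M p)) -trZr.
  have -> : h l k * M p q = tr (fun r s => h l k * (M p r * g s q)).
    by rewrite trZ trgE.
  rewrite -!trB -trD -trB; apply: eq_tr => r s.
  by rewrite /kn (hsym q l) (gsym s k); ring.
rewrite (eq_tr gi e) trB trD trB !trgE !trZ; congr (_ - _ * _ + _ - _).
by apply: eq_tr => a b; apply: eq_tr => r s; rewrite (hsym s).
Qed.

Lemma curv_apply_kn (f : 'I_n -> 'I_n -> A) (fsym : forall i j, f i j = f j i) i k :
  curv_apply gi f K i k = h i k * tr f + inner2 gi f h * g i k
    - prod2 gi f h i k - prod2 gi f h k i.
Proof.
rewrite /curv_apply.
have e a b : tr (fun c e => f a c * K i b k e) =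
    h i k * f a b - tr (fun c e => f a c * h i e) * g b k
    + tr (fun c e => f a c * h b e) * g i k - h b k * f a i.
  have -> : h i k * f a b = tr (fun c e => h i k * (f a c * g b e)).
    by rewrite trZ trgE.
  have -> : h b k * f a i = tr (fun c e => h b k * (f a c * g i e)).
    by rewrite trZ trgE.
  rewrite -!trZr -!trB -trD -trB; apply: eq_tr => c e.
  by rewrite /kn; ring.
rewrite (eq_tr gi e) trB trD trB trZ trZr !trgE.
have -> : tr (fun c e => f k c * h i e) = prod2 gi f h k i.
  by apply: eq_tr => c m; rewrite (hsym i).
have -> : tr (fun a b => h b k * f a i) = prod2 gi f h i k.
  by apply: eq_tr => c m; rewrite mulrC (fsym c).
by rewrite /inner2; ring.
Qed.

Lemma ric_act_kn (f : 'I_n -> 'I_n -> A) (fsym : forall i j, f i j = f j i) i j k l :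
  ric_act gi f K i j k l =
  kn (prod2 gi f h) g i j k l + kn (fun a b => prod2 gi f h b a) g i j k l
  + (kn h f i j k l + kn h f i j k l).
Proof.
have e1 i' j' k' l' : tr (fun p q => f i' p * K q j' k' l') = prod2 gi f h i' k' * g j' l'
   - prod2 gi f h i' l' * g j' k' + h j' l' * f i' k' - h j' k' * f i' l'.
  transitivity (tr (fun p q => f i' p * h q k' * g j' l' - f i' p * h q l' * g j' k'
    + h j' l' * (f i' p * g q k') - h j' k' * (f i' p * g q l'))).
    by apply: eq_tr => p q; rewrite /kn; ring.
  by rewrite trB trD trB !trZr !trZ !trgE.
have [K1 K2 _] := kn_alg; have Kp := alg_curv_pair halfP kn_alg.
rewrite /ric_act !trD e1.
have -> : tr (fun p q => f j p * K i q k l) = - tr (fun p q => f j p * K q i k l).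
  by rewrite -trN; apply: eq_tr => p q; rewrite K1 mulrN.
have -> : tr (fun p q => f k p * K i j q l) = tr (fun p q => f k p * K q l i j).
  by apply: eq_tr => p q; rewrite Kp.
have -> : tr (fun p q => f l p * K i j k q) = - tr (fun p q => f l p * K q k i j).
  by rewrite -trN; apply: eq_tr => p q; rewrite K2 Kp mulrN.
rewrite !e1 /kn (gsym l j) (gsym l i) (gsym k j) (gsym k i).
rewrite (hsym l j) (hsym l i) (hsym k j) (hsym k i) (fsym k i) (fsym k j) (fsym l i) (fsym l j).
ring.
Qed.

Definition wedge (u v : 'I_n -> 'I_n -> A) i j k l := u i k * v j l - u i l * v j k.

Lemma quad_sum_kn_kn i j k l : quad_sum gi K K i j k l =
  (n%:R - 2) * wedge h h i j k l - kn h2 g i j k l + tr h * kn h g i j k l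
  + hh * wedge g g i j k l.
Proof.
pose H := tr h; pose N : A := n%:R.
have B i' j' k' l' : quad gi K K i' j' k' l' =
    (h l' j' * h i' k' - g i' j' * h2 l' k' + g l' j' * h2 i' k' - h i' j' * h l' k')
    - g l' k' * (h2 i' j' + h2 i' j' - hh * g i' j' - h i' j' * H)
    + (h2 j' l' * g i' k' - h2 k' l' * g i' j' + h i' k' * h j' l' - h i' j' * h k' l')
    - h l' k' * (h i' j' + h i' j' - H * g i' j' - N * h i' j').
  rewrite /quad tr_tr_kn; congr (_ - _ * _ + _ - _ * _).
  - transitivity (tr (fun r s => h l' j' * (h s k' * g i' r) - g i' j' * (h l' r * h s k')
      + g l' j' * (h i' r * h s k') - h i' j' * (h s k' * g l' r))).
      by apply: eq_tr => r s; rewrite /kn; ring.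
    by rewrite trB trD trB !trZ !trgE.
  - have e p q : tr (fun r s => K p i' j' r * h q s) =
      h p j' * h q i' - tr (fun r s => h p r * h q s) * g i' j'
      + g p j' * h2 q i' - h i' j' * h q p.
      transitivity (tr (fun r s => h p j' * (g i' r * h q s) - h p r * h q s * g i' j'
        + g p j' * (h q s * h r i') - h i' j' * (g p r * h q s))).
        by apply: eq_tr => r s; rewrite /kn (hsym r i'); ring.
      rewrite trB trD trB !trZ trZr !trgE; congr (_ - _ + _ * _ - _).
      by rewrite /prod2 -[RHS](tr_swap gisym).
    rewrite /inner2 (eq_tr gi e) trB trD trB !trZ trZr trgE -/hh.
    have -> : tr (fun p q => h q p) = H by rewrite tr_swap.
    have -> : tr (fun p q => h p j' * h q i') = h2 i' j'.
      by rewrite /prod2 -[RHS](tr_swap gisym); apply: eq_tr => p q; rewrite mulrC (hsym i').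
    rewrite (prod2_sym j'); ring.
  - transitivity (tr (fun p q => h p j' * h q l' * g i' k' - h p k' * h q l' * g i' j'
      + h i' k' * (g p j' * h q l') - h i' j' * (g p k' * h q l'))).
      by apply: eq_tr => r s; rewrite /kn; ring.
    rewrite trB trD trB !trZ !trZr !trgE.
    have e x y : tr (fun p q => h p x * h q y) = h2 x y.
      by apply: eq_tr => p q; rewrite (hsym x).
    by rewrite !e.
  - transitivity (tr (fun p r => h p j' * g i' r - h p r * g i' j'
      + h i' r * g p j' - h i' j' * g p r)).
      by apply: eq_tr => r s; rewrite /kn; ring.
    by rewrite trB trD trB !trZ !trZr !trgE (tr_gg gsym gV) /N /H; ring.
rewrite /quad_sum !B /kn /wedge -/N -/H.
have hs := hsym; have gs := gsym; have h2s := prod2_sym.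
rewrite ?(hs j i) ?(hs k j) ?(hs k i) ?(hs l j) ?(hs l k) ?(hs l i).
rewrite ?(gs j i) ?(gs k j) ?(gs k i) ?(gs l j) ?(gs l k) ?(gs l i).
rewrite ?(h2s j i) ?(h2s k j) ?(h2s k i) ?(h2s l j) ?(h2s l k) ?(h2s l i).
ring.
Qed.

Section CrossTerms.
Variable W : 'I_n -> 'I_n -> 'I_n -> 'I_n -> A.
Hypothesis WP : alg_curv W.
Hypothesis ricW : forall i k, ric gi W i k = 0.
Let W1 i j k l : W i j k l = - W j i k l. Proof. by case: WP. Qed.
Let W2 i j k l : W i j k l = - W i j l k. Proof. by case: WP. Qed.
Let Wpair i j k l : W i j k l = W k l i j.
Proof. exact: (alg_curv_pair halfP WP). Qed.
Local Notation F := (curv_apply gi h W).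

Lemma curv_apply_sym i k : F i k = F k i.
Proof.
rewrite /curv_apply [RHS]tr_exch; apply: eq_tr => a b; apply: eq_tr => c m.
by rewrite Wpair (hsym a).
Qed.

Let E a b c m := tr (fun r s => W a b c r * h s m).

Lemma quad_weyl_kn i j k l :
  quad gi W K i j k l = E l i j k + E k j i l + g l k * F i j.
Proof.
rewrite /quad tr_tr_kn (tr14 gi WP) ricW oppr0 mulr0 subr0.
have -> : inner2 gi (fun p r => W p i j r) h = - F i j.
  rewrite /inner2 /curv_apply -trN -(tr_swap gisym); apply: eq_tr => a b.
  rewrite -trN -(tr_swap gisym); apply: eq_tr => c m.
  by rewrite mulrC W1 mulrN.
have -> : tr (fun p q => W p i j k * h q l) = E k j i l.
  by apply: eq_tr => p q; rewrite Wpair W1 W2 opprK.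
rewrite /E; ring.
Qed.

(** The terms in which one index of h is contracted with W cancel in the
    antisymmetrised sum, because W is antisymmetric in its first two
    indices. What survives is the full contraction F of h with W; no trace
    of W occurs, as W is trace-free. *)
Lemma quad_sum_cross i j k l :
  quad_sum gi W K i j k l + quad_sum gi K W i j k l = kn F g i j k l.
Proof.
have sw i' j' k' l' : quad gi K W i' j' k' l' = quad gi W K k' l' i' j'.
  exact: (quad_swap halfP gisym kn_alg WP).
have E1 a b c m : E a b c m = - E b a c m.
  by rewrite /E -trN; apply: eq_tr => p q; rewrite W1 mulNr.
rewrite /quad_sum !sw !quad_weyl_kn /kn.
have Fs := curv_apply_sym; have gs := gsym.
rewrite (E1 l i j k) (E1 l j i k) (E1 k j i l) (E1 k i j l).
rewrite (E1 k j l i) (E1 l j k i) (E1 l i k j) (E1 k i l j).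
rewrite ?(Fs j i) ?(Fs k j) ?(Fs k i) ?(Fs l j) ?(Fs l k) ?(Fs l i).
rewrite ?(gs j i) ?(gs k j) ?(gs k i) ?(gs l j) ?(gs l k) ?(gs l i).
ring.
Qed.

Lemma quad_sum_decomp i j k l (T : 'I_n -> 'I_n -> 'I_n -> 'I_n -> A)
    (TE : forall i j k l, T i j k l = W i j k l + K i j k l) :
  quad_sum gi T T i j k l = quad_sum gi W W i j k l + kn F g i j k l
                        + quad_sum gi K K i j k l.
Proof.
have B i' j' k' l' : quad gi T T i' j' k' l' = quad gi W W i' j' k' l'
   + quad gi W K i' j' k' l' + quad gi K W i' j' k' l' + quad gi K K i' j' k' l'.
  rewrite /quad -!trD; apply: eq_tr => p q; rewrite -!trD; apply: eq_tr => r s.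
  by rewrite !TE; ring.
by rewrite -quad_sum_cross /quad_sum !B; ring.
Qed.

End CrossTerms.
End General.
End WeylAlgebra.

(** * The reaction terms of the Weyl tensor *)

Section WeylTensor.
Variables (A : comPzRingType) (n : nat).
Variables (g gi : 'I_n -> 'I_n -> A) (half x y : A).
Hypothesis halfP : half + half = 1.
Hypothesis gsym : forall i j, g i j = g j i.
Hypothesis gisym : forall i j, gi i j = gi j i.
Hypothesis gV : forall i j, \sum_k gi i k * g k j = (i == j)%:R.
Hypothesis xP : x * (n%:R - 2) = 1.
Hypothesis yP : y * (n%:R - 1) = 1.
Local Notation tr := (tr gi).
Local Notation N := (n%:R : A).

Definition weyl_of R i j k l : A :=
  R i j k l + tr (ric gi R) * (x * y) * wedge g g i j k l
  - x * kn (ric gi R) g i j k l.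

Variable R : 'I_n -> 'I_n -> 'I_n -> 'I_n -> A.
Hypothesis RP : alg_curv R.
Local Notation Ric := (ric gi R).
Local Notation S := (tr Ric).
Local Notation W := (weyl_of R).
Let Ricsym i k : Ric i k = Ric k i.
Proof. exact: (ric_sym halfP gisym RP). Qed.

Let s := half * S.
Let Ss : S = s + s. Proof. by rewrite /s -mulrDl halfP mul1r. Qed.
Let xN : x * N = 1 + 2 * x. Proof. by transitivity (x * (N - 2) + 2 * x); [ring | rewrite xP]. Qed.
Let yN : y * N = 1 + y. Proof. by transitivity (y * (N - 1) + y); [ring | rewrite yP]. Qed.
Let xy : x * y = x - y.
Proof.
transitivity (x * (y * (N - 1)) - y * (x * (N - 2))); first by ring.
by rewrite xP yP !mulr1.
Qed.

(** The tensor h for which R = W + h /\ g: since s = S / 2 and x - y = 1 /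
    ((n-1)(n-2)), it is (Ric - S / (2 (n-1)) g) / (n-2). *)
Definition schouten i j := x * Ric i j - (x - y) * s * g i j.
Local Notation h := schouten.
Local Notation K := (kn h g).

Lemma schouten_sym i j : h i j = h j i.
Proof. by rewrite /h Ricsym gsym. Qed.

Lemma riemann_decomp i j k l : R i j k l = W i j k l + K i j k l.
Proof. by rewrite /weyl_of Ss /kn /wedge /h; ring: xy. Qed.

Let KP : alg_curv K := kn_alg gsym schouten_sym.

Lemma weyl_alg : alg_curv W.
Proof.
have e i j k l : W i j k l = R i j k l - K i j k l by rewrite riemann_decomp addrK.
have [R1 R2 R3] := RP; have [K1 K2 K3] := KP.
split=> i j k l; rewrite !e; first by rewrite R1 K1; ring.
  by rewrite R2 K2; ring.
transitivity ((R i j k l + R j k i l + R k i j l)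
              - (K i j k l + K j k i l + K k i j l)); first by ring.
by rewrite R3 K3 subrr.
Qed.

Lemma tr_schouten : tr h = x * S - (x - y) * s * N.
Proof. by rewrite /h trB !trZ (tr_gg gsym gV). Qed.

Lemma ric_weyl i k : ric gi W i k = 0.
Proof.
have -> : ric gi W i k = Ric i k - ric gi K i k.
  by rewrite /ric -trB; apply: eq_tr => a b; rewrite riemann_decomp addrK.
rewrite (ric_kn gsym gisym gV) tr_schouten /h Ss; ring: xN yN xy.
Qed.

Lemma curv_apply_schouten i k : curv_apply gi h W i k = x * curv_apply gi Ric W i k.
Proof.
rewrite /curv_apply -trZ; rewrite -[LHS]addr0.
have <- : (x - y) * s * tr (fun a b => tr (fun c e => g a c * W i b k e)) = 0.
  have -> : tr (fun a b => tr (fun c e => g a c * W i b k e)) = tr (fun a b => W i b k a).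
    by apply: eq_tr => a b; rewrite (trgE gsym gisym gV).
  by rewrite (tr_swap gisym) [tr _]ric_weyl mulr0.
rewrite -trZ -trD; apply: eq_tr => a b; rewrite -!trZ -trD; apply: eq_tr => c e.
by rewrite /h; ring.
Qed.

Lemma prod2_Ric_schouten i k :
  prod2 gi Ric h i k = x * prod2 gi Ric Ric i k - (x - y) * s * Ric i k.
Proof.
rewrite -[Ric i k](tr_gr gsym gisym gV k (Ric i)) -!trZ -trB.
by apply: eq_tr => a b; rewrite /h; ring.
Qed.

Lemma prod2_schouten i k :
  prod2 gi h h i k = x * x * prod2 gi Ric Ric i k
   - 2 * x * ((x - y) * s) * Ric i k + ((x - y) * s) ^+ 2 * g i k.
Proof.
transitivity (tr (fun p q => x * x * (Ric i p * Ric q k)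
   - x * ((x - y) * s) * (Ric i p * g q k) - x * ((x - y) * s) * (g i p * Ric q k)
   + ((x - y) * s) ^+ 2 * (g i p * g q k))).
  by apply: eq_tr => p q; rewrite /h; ring.
by rewrite trD !trB !trZ !(trgE gsym gisym gV) /prod2; ring.
Qed.

Lemma inner2_Ric_schouten :
  inner2 gi Ric h = x * inner2 gi Ric Ric - (x - y) * s * S.
Proof.
rewrite /inner2 -!trZ -trB; apply: eq_tr => a b.
transitivity (tr (fun c e => x * (Ric a c * Ric b e)
   - (x - y) * s * (Ric a c * g b e))).
  by apply: eq_tr => c e; rewrite /h; ring.
by rewrite trB !trZ !(trgE gsym gisym gV).
Qed.

Lemma inner2_schouten : inner2 gi h h = x * x * inner2 gi Ric Ric
   - 2 * x * ((x - y) * s) * S + ((x - y) * s) ^+ 2 * N.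
Proof.
have -> : inner2 gi h h = x * inner2 gi Ric h - (x - y) * s * tr h.
  rewrite /inner2 -!trZ -trB; apply: eq_tr => a b.
  transitivity (tr (fun c e => x * (Ric a c * h b e)
     - (x - y) * s * (g a c * h b e))).
    by apply: eq_tr => c e; rewrite {1}/h; ring.
  by rewrite trB !trZ !(trgE gsym gisym gV) (schouten_sym b).
by rewrite inner2_Ric_schouten tr_schouten; ring.
Qed.

(** The algebraic core: substitute R = W + h /\ g in the reaction term of
    the curvature. Every term that is linear in W, apart from the action of
    Ric on W, cancels, and the rest is a comparison of the coefficients of
    Ric2 /\ g, Ric /\ Ric, Ric /\ g and g /\ g. *)
Lemma weyl_reaction i j k l (LRic := fun i k =>
    2 * curv_apply gi Ric R i k - 2 * prod2 gi Ric Ric i k) :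
  2 * quad_sum gi R R i j k l - ric_act gi Ric R i j k l
  + x * y * (2 * inner2 gi Ric Ric * wedge g g i j k l - 2 * S * kn Ric g i j k l)
  - x * (kn LRic g i j k l - 4 * wedge Ric Ric i j k l) =
  2 * quad_sum gi W W i j k l - ric_act gi Ric W i j k l
  + 2 * x ^+ 2 * kn (prod2 gi Ric Ric) g i j k l
  - 2 * S * x ^+ 2 * kn Ric g i j k l
  + 2 * x * wedge Ric Ric i j k l
  + 2 * (S ^+ 2 - inner2 gi Ric Ric) * (y * x ^+ 2) * wedge g g i j k l.
Proof.
have -> : ric_act gi Ric R i j k l =
   ric_act gi Ric W i j k l + ric_act gi Ric K i j k l.
  rewrite /ric_act -trD; apply: eq_tr => p q.
  by rewrite 4!riemann_decomp; ring.
rewrite (quad_sum_decomp halfP gsym gisym gV schouten_sym weyl_alg ric_weyl _ _ _ _ riemann_decomp).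
rewrite (quad_sum_kn_kn gsym gisym gV schouten_sym).
rewrite (ric_act_kn halfP gsym gisym gV schouten_sym Ricsym).
have eL a b : curv_apply gi Ric R a b = curv_apply gi Ric W a b + (h a b * S
    + inner2 gi Ric h * g a b - prod2 gi Ric h a b - prod2 gi Ric h b a).
  rewrite -(curv_apply_kn gsym gisym gV schouten_sym Ricsym) /curv_apply -trD.
  apply: eq_tr => p q; rewrite -trD; apply: eq_tr => r t.
  by rewrite riemann_decomp; ring.
rewrite /kn /wedge /LRic !eL !curv_apply_schouten tr_schouten inner2_schouten.
rewrite inner2_Ric_schouten !prod2_schouten !prod2_Ric_schouten /h.
have Rs := Ricsym; have gs := gsym.
have Ps a b : prod2 gi Ric Ric a b = prod2 gi Ric Ric b a.
  rewrite /prod2 -(tr_swap gisym); apply: eq_tr => p q.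
  by rewrite mulrC (Ricsym a) (Ricsym p).
rewrite ?(Rs j i) ?(Rs k j) ?(Rs k i) ?(Rs l j) ?(Rs l k) ?(Rs l i).
rewrite ?(gs j i) ?(gs k j) ?(gs k i) ?(gs l j) ?(gs l k) ?(gs l i).
rewrite ?(Ps j i) ?(Ps k j) ?(Ps k i) ?(Ps l j) ?(Ps l k) ?(Ps l i).
rewrite Ss.
have xxy : y * x ^+ 2 = x ^+ 2 - x * y by rewrite expr2 mulrCA mulrA xy; ring: xy.
set c := (x - y) * s; have cE : c = (x - y) * s by []; clearbody c.
have xxs : x ^+ 2 * s = x * c + x * y * s by rewrite cE; ring.
have c2 : c ^+ 2 = c * ((x - y) * s) by rewrite -cE.
have Ncc : N * c ^+ 2 = c ^+ 2 + x * c * s.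
  transitivity ((x * N - y * N) * c * s); first by rewrite c2; ring.
  by rewrite xN yN c2; ring.
(* The difference of the two sides is a combination of the relations xN, xxs,
   Ncc and xxy between x, y, c and n. *)
apply/eqP; rewrite -subr_eq0; apply/eqP.
pose w := Ric i k * Ric j l - Ric i l * Ric j k.
pose r := Ric i k * g j l - Ric i l * g j k + Ric j l * g i k - Ric j k * g i l.
pose G := g i k * g j l - g i l * g j k.
transitivity ((2 * x * w - 4 * c * r) * (x * N - (1 + 2 * x))
  + (4 * r - 8 * s * G) * (x ^+ 2 * s - (x * c + x * y * s))
  + 8 * G * (N * c ^+ 2 - (c ^+ 2 + x * c * s))
  + (2 * inner2 gi Ric Ric - 8 * s ^+ 2) * G * (y * x ^+ 2 - (x ^+ 2 - x * y))).
  by rewrite /w /r /G; ring.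
by rewrite xN xxs Ncc xxy !subrr !mulr0 !addr0.
Qed.

End WeylTensor.

(** * Evolution of the Weyl tensor *)

Section WeylEvolution.
Variables (A : comPzRingType) (n : nat) (d : 'I_n -> A -> A) (dt : A -> A).
Hypothesis dP : forall p, derivation (d p).
Hypothesis dC : forall p q u, d p (d q u) = d q (d p u).
Hypothesis dtP : derivation dt.
Hypothesis dtC : forall p u, dt (d p u) = d p (dt u).
Variables (g gi : 'I_n -> 'I_n -> A) (half x y : A).
Hypothesis halfP : half + half = 1.
Hypothesis gsym : forall i j, g i j = g j i.
Hypothesis gisym : forall i j, gi i j = gi j i.
Hypothesis gV : forall i j, \sum_k gi i k * g k j = (i == j)%:R.
Hypothesis xP : x * (n%:R - 2) = 1.
Hypothesis yP : y * (n%:R - 1) = 1.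
Local Notation tr := (tr gi).
Local Notation Gam := (levi d g gi half).
Local Notation covd := (covd d Gam).
Local Notation nabla := (nabla d Gam).
Local Notation hess := (hess d Gam).
Local Notation lap := (laplacian d g gi half).
Local Notation R := (riemann d g gi half).
Local Notation Ric := (ric gi R).
Local Notation S := (tr Ric).
Local Notation W := (weyl_of g gi x y R).
Hypothesis flow : forall i j, dt (g i j) = - (Ric i j + Ric i j).

Let RP := riemann_alg dP dC halfP gsym gisym gV.
Let Ricsym i k : Ric i k = Ric k i.
Proof. exact: (ric_sym halfP gisym RP). Qed.

Let const_der (D : A -> A) (DP : derivation D) : D x = 0 /\ D y = 0.
Proof.
have D0 (m : A) k : m * (n%:R - k%:R) = 1 -> D m = 0.
  move=> mP; apply: (der_inverse_const DP mP).
  by rewrite (derB DP) !(der_nat DP) subrr.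
by split; [apply: (D0 x 2%N) | apply: (D0 y 1%N)].
Qed.

Lemma covd_metric_tensor r v : size v = 2 -> covd r v (tens2 g) = 0.
Proof.
by case: v => [|a [|b [|? ?]]] // _; apply: (covd_metric d halfP gsym gisym gV).
Qed.

Lemma covd_wedge_metric r v : size v = 4 -> covd r v (tens4 (wedge g g)) = 0.
Proof.
case: v => [|a [|b [|c [|e [|? ?]]]]] // _.
pose m1 := [:: true; false; true; false]; pose m2 := [:: true; false; false; true].
pose P m (u : seq 'I_n) := tens2 g (mask m u) * tens2 g (mask (map negb m) u).
transitivity (covd r [:: a; b; c; e] (fun u => P m1 u - P m2 u)).
  by apply: eq_covd => -[|? [|? [|? [|? [|? ?]]]]].
by rewrite (covdB dP) !(covd_mul_parallel dP) ?subrr // covd_metric_tensor.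
Qed.

Lemma laplacian_wedge_metric f i j k l :
  lap (tens4 (fun i j k l => f * wedge g g i j k l)) [:: i; j; k; l]
  = lap (tens0 f) [::] * wedge g g i j k l.
Proof.
rewrite /laplacian -trZr; apply: eq_tr => p q.
pose m := nseq 4 false.
rewrite -[LHS]/(hess _ p q [:: i; j; k; l]).
transitivity (hess (fun u => tens0 f (mask m u) * tens4 (wedge g g) (mask (map negb m) u)) p q [:: i; j; k; l]).
  by apply: eq_hess => -[|? [|? [|? [|? [|? ?]]]]].
rewrite (hess_mul_parallel dP) //= => r v sv; exact: covd_wedge_metric.
Qed.

Lemma laplacian_kn_metric f i j k l :
  lap (tens4 (kn f g)) [:: i; j; k; l]
  = kn (fun a b => lap (tens2 f) [:: a; b]) g i j k l.
Proof.
pose m1 := [:: true; false; true; false]; pose m2 := [:: true; false; false; true].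
pose P m (u : seq 'I_n) := tens2 f (mask m u) * tens2 g (mask (map negb m) u).
rewrite /kn /laplacian -!trZr -trB -trD -trB; apply: eq_tr => p q.
transitivity (hess (fun u => P m1 u - P m2 u + P (map negb m1) u - P (map negb m2) u) p q [:: i; j; k; l]).
  by apply: eq_hess => -[|? [|? [|? [|? [|? ?]]]]].
rewrite (hessB dP) (hessD dP) (hessB dP) /P.
rewrite !(hess_mul_parallel dP) //= => r v sv; exact: covd_metric_tensor.
Qed.

(** The metric is parallel and the dimensional constants are constant, so
    both operators act on W through R, Ric and S, and the evolution
    equations of these reduce the claim to [weyl_reaction]. *)
Lemma weyl_evolution i j k l :
  dt (W i j k l) - lap (tens4 W) [:: i; j; k; l] =
  2 * quad_sum gi W W i j k l - ric_act gi Ric W i j k l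
  + 2 * x ^+ 2 * kn (prod2 gi Ric Ric) g i j k l
  - 2 * S * x ^+ 2 * kn Ric g i j k l
  + 2 * x * wedge Ric Ric i j k l
  + 2 * (S ^+ 2 - inner2 gi Ric Ric) * (y * x ^+ 2) * wedge g g i j k l.
Proof.
rewrite -(weyl_reaction halfP gsym gisym gV xP yP RP).
have [dtx dty] := const_der dtP.
have dx p : d p x = 0 by case: (const_der (dP p)).
have dy p : d p y = 0 by case: (const_der (dP p)).
have dxy p : d p (x * y) = 0 by rewrite (derM (dP p)) dx dy mul0r mulr0 addr0.
have Lric a b : dt (Ric a b) - lap (tens2 Ric) [:: a; b] =
    2 * curv_apply gi Ric R a b - 2 * prod2 gi Ric Ric a b.
  rewrite (ric_evolution dP dC halfP gsym gisym gV dtP dtC flow) trB trD.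
  rewrite !(trace_quad_sum halfP gisym RP) (trace_ric_act halfP gisym RP) /curv_apply; ring.
have Lscal : dt S - lap (tens0 S) [::] = 2 * inner2 gi Ric Ric.
  rewrite (scal_evolution dP halfP gsym gisym gV dtP flow).
  under eq_tr do rewrite Lric.
  rewrite trB !trZ [X in 2 * X - _](trace_curv_apply gi RP).
  rewrite [X in _ - 2 * X](trace_prod2 halfP gisym RP) /inner2; ring.
have LR := riemann_evolution dP dC halfP gsym gisym gV dtP dtC flow i j k l.
have lapW : lap (tens4 W) [:: i; j; k; l] = lap (tens4 R) [:: i; j; k; l]
    + x * y * (lap (tens0 S) [::] * wedge g g i j k l)
    - x * kn (fun a b => lap (tens2 Ric) [:: a; b]) g i j k l.
  rewrite -laplacian_wedge_metric -laplacian_kn_metric /laplacian -!trZ -trD -trB.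
  apply: eq_tr => p q.
  rewrite -(hessZ dP) // -(hessZ dP) // -(hessD dP) -(hessB dP).
  by apply: eq_hess => -[|? [|? [|? [|? [|? ?]]]]] //= _; rewrite /weyl_of; ring.
have dtW : dt (W i j k l) = dt (R i j k l)
    + x * y * (dt S * wedge g g i j k l - 2 * S * kn Ric g i j k l)
    - x * (kn (fun a b => dt (Ric a b)) g i j k l - 4 * wedge Ric Ric i j k l).
  rewrite /weyl_of (derB dtP) (derD dtP).
  rewrite [dt (x * _)](derM dtP) dtx mul0r add0r.
  rewrite [dt (S * _ * _)](derM dtP) [dt (S * _)](derM dtP) [dt (x * y)](derM dtP) dtx dty.
  rewrite /kn /wedge !(derB dtP, derD dtP).
  rewrite ![dt (Ric _ _ * g _ _)](derM dtP) ![dt (g _ _ * g _ _)](derM dtP) !flow.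
  ring.
rewrite dtW lapW; move: LR => /eqP; rewrite subr_eq => /eqP ->.
move/eqP: Lscal; rewrite subr_eq => /eqP ->.
have Lric' a b : dt (Ric a b) = 2 * curv_apply gi Ric R a b - 2 * prod2 gi Ric Ric a b
   + lap (tens2 Ric) [:: a; b] by rewrite -Lric subrK.
by rewrite /kn !Lric'; ring.
Qed.

End WeylEvolution.

(** * Derivatives within a time interval *)

Section TimeDerivative.
Variables (R : realType) (I : set R).
Hypothesis I_interval : is_interval I.
Hypothesis I_interior : interior I !=set0.

Lemma interval_one_sided t : I t ->
  (exists2 u, t < u & I u) \/ (exists2 u, u < t & I u).
Proof.
move=> It; have [u0 [e /= e0 eI]] := I_interior.
have Iu0 : I u0 by apply: eI; exact: ballxx.
have Iu1 : I (u0 + e / 2).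
  apply: eI; rewrite /ball /= opprD addrA subrr sub0r normrN gtr0_norm ?divr_gt0 //.
  by rewrite ltr_pdivrMr // ltr_pMr // ltr1n.
case: (ltgtP t u0) => [tu0|u0t|tu0]; first by left; exists u0.
  by right; exists u0.
by left; exists (u0 + e / 2) => //; rewrite tu0 ltrDl divr_gt0.
Qed.

(** Limits within I are unique, since an interval with nonempty interior
    has no isolated point. *)
Lemma within_dnbhs_proper t : I t -> ProperFilter (within I t^').
Proof.
move=> It; split; last exact: within_filter.
rewrite /within /= => -[e /= e0 eI].
case: (interval_one_sided It) => -[u tu Iu].
- pose s := Num.min u (t + e / 2).
  have ts : t < s by rewrite lt_min tu ltrDl divr_gt0.
  have sue : s <= u /\ s <= t + e / 2 by rewrite !ge_min !lexx orbT.
  apply: (eI s) => /=; last by apply: (I_interval It Iu); rewrite (ltW ts) sue.1.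
    by rewrite /ball /= distrC ger0_norm ?subr_ge0 ?(ltW ts) //; have := sue.2; lra.
  by rewrite gt_eqF.
- pose s := Num.max u (t - e / 2).
  have st : s < t by rewrite gt_max tu gtrDl oppr_lt0 divr_gt0.
  have sue : u <= s /\ t - e / 2 <= s by rewrite !le_max !lexx orbT.
  apply: (eI s) => /=; last by apply: (I_interval Iu It); rewrite (ltW st) sue.1.
    by rewrite /ball /= ger0_norm ?subr_ge0 ?(ltW st) //; have := sue.2; lra.
  by rewrite lt_eqF.
Qed.

Definition is_tderive (f : R -> R) (t l : R) : Prop :=
  tquot f t s @[s --> within I t^'] --> l.

Lemma tderivableP f t : tderivable I f t -> is_tderive f t (tderive I f t).
Proof. by []. Qed.

Lemma is_tderive_derivable f t l : is_tderive f t l -> tderivable I f t.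
Proof. by move=> fl; apply/cvg_ex; exists l. Qed.

Lemma is_tderiveE f t l : I t -> is_tderive f t l -> tderive I f t = l.
Proof.
by move=> It; have ? := within_dnbhs_proper It; apply: cvg_lim.
Qed.

Lemma eq_is_tderive f f' t l : I t -> (forall s, I s -> f s = f' s) ->
  is_tderive f t l -> is_tderive f' t l.
Proof.
move=> It e; apply: cvg_trans; apply: near_eq_cvg.
by apply: filterS (withinT I _) => s Is; rewrite /tquot !e.
Qed.

Lemma eq_tderivable f f' t : I t -> (forall s, I s -> f s = f' s) ->
  tderivable I f t -> tderivable I f' t.
Proof.
by move=> It e /tderivableP/(eq_is_tderive It e)/is_tderive_derivable.
Qed.

Lemma eq_tderive f f' t : I t -> (forall s, I s -> f s = f' s) ->
  tderive I f t = tderive I f' t.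
Proof.
move=> It e; congr (lim _); rewrite eqEsubset; split;
  by apply: near_eq_cvg; apply: filterS (withinT I _) => s Is; rewrite /tquot !e.
Qed.

Lemma is_tderive_cst c t : is_tderive (fun=> c) t 0.
Proof.
rewrite /is_tderive /tquot; under eq_fun do rewrite subrr mulr0.
exact: cvg_cst.
Qed.

Lemma is_tderiveD f f' t l l' : is_tderive f t l -> is_tderive f' t l' ->
  is_tderive (fun s => f s + f' s) t (l + l').
Proof.
move=> fl fl'; rewrite /is_tderive.
have -> : tquot (fun s => f s + f' s) t = fun s => tquot f t s + tquot f' t s.
  by apply: funext => s; rewrite /tquot; ring.
exact: cvgD.
Qed.

Lemma is_tderive_continuous f t l : is_tderive f t l ->
  f s @[s --> within I t^'] --> f t.
Proof.
move=> fl.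
have h : (s - t) * tquot f t s @[s --> within I t^'] --> 0 * l.
  have idt : s @[s --> within I t^'] --> t.
    by move=> A At; apply: (filterS (F := nbhs t) _ At) => s As _ _.
  by apply: cvgM => //; rewrite -(subrr t); apply: cvgB => //; exact: cvg_cst.
rewrite mul0r in h.
have h' : (s - t) * tquot f t s + f t @[s --> within I t^'] --> 0 + f t.
  by apply: cvgD => //; exact: cvg_cst.
move: h'; rewrite add0r; apply: cvg_trans; apply: near_eq_cvg.
rewrite near_withinE; near=> s => _ /=.
rewrite /tquot mulrA mulfV ?mul1r ?subrK // subr_eq0.
by near: s; exact: nbhs_dnbhs_neq.
Unshelve. all: by end_near. Qed.

Lemma is_tderiveM f f' t l l' : is_tderive f t l -> is_tderive f' t l' ->
  is_tderive (fun s => f s * f' s) t (l * f' t + f t * l').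
Proof.
move=> fl fl'; have fc := is_tderive_continuous fl; rewrite /is_tderive.
have -> : tquot (fun s => f s * f' s) t =
    fun s => tquot f t s * f' t + f s * tquot f' t s.
  by apply: funext => s; rewrite /tquot; ring.
by apply: cvgD; apply: cvgM => //; exact: cvg_cst.
Qed.

Lemma is_tderiveV f t l : f t != 0 -> is_tderive f t l ->
  is_tderive (fun s => (f s)^-1) t (- l * (f t)^-1 * (f t)^-1).
Proof.
move=> ft0 fl; have fc := is_tderive_continuous fl.
have h : - tquot f t s * (f s)^-1 * (f t)^-1 @[s --> within I t^'] -->
         - l * (f t)^-1 * (f t)^-1.
  apply: cvgM; last exact: cvg_cst.
  by apply: cvgM; [exact: cvgN | exact: cvgV].
move: h; apply: cvg_trans; apply: near_eq_cvg.
have fn0 : \forall s \near within I t^', f s != 0 by exact: cvgr_neq0 fc ft0.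
near=> s; have fs0 : f s != 0 by near: s.
rewrite /tquot -mulrN -!mulrA; congr (_ * _).
by field; rewrite ft0 fs0.
Unshelve. all: by end_near. Qed.

End TimeDerivative.

(** * Stability of smoothness *)

Section SmoothFunctions.
Variables (R : realType) (n : nat) (I : set R) (V : set 'rV[R]_n).
Hypothesis I_interval : is_interval I.
Hypothesis I_interior : interior I !=set0.
Hypothesis V_open : open V.
Implicit Types f g : R -> 'rV[R]_n -> R.

Local Notation Ck_time k f := (Ck_time k I V f).
Local Notation dt f := (fun t x => tderive I (f^~ x) t).
Local Notation dx i f := (fun t => partial i (f t)).

Definition eq_on f g := forall t x, I t -> V x -> f t x = g t x.

Lemma eq_on_near f g t x : eq_on f g -> I t -> V x -> {near x, f t =1 g t}.
Proof.
move=> e It Vx; near=> y; apply: e => //; near: y.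
exact: open_nbhs_nbhs.
Unshelve. all: by end_near. Qed.

Lemma eq_dx f g i : eq_on f g -> eq_on (dx i f) (dx i g).
Proof. by move=> e t x It Vx; apply: near_eq_derive; apply: eq_on_near. Qed.

Lemma eq_dt f g : eq_on f g -> eq_on (dt f) (dt g).
Proof. by move=> e t x It Vx; apply: eq_tderive => // s Is; apply: e. Qed.

Lemma Ck_time_eq k f g : eq_on f g -> Ck_time k f -> Ck_time k g.
Proof.
elim: k f g => [|k IH] f g e /= [cf df].
  split=> //; apply: subspace_eq_continuous cf => -[t x].
  by rewrite inE => -[It Vx]; apply: e.
split.
  apply: subspace_eq_continuous cf => -[t x].
  by rewrite inE => -[It Vx]; apply: e.
case: df => [tf Ctf xf]; split.
- by move=> t x It Vx; apply: eq_tderivable (tf t x It Vx) => // s Is; apply: e.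
- by apply: IH Ctf; apply: eq_dt.
- move=> i; have [dxf Cxf] := xf i; split; last by apply: IH Cxf; apply: eq_dx.
  move=> t x It Vx; apply: near_eq_derivable (dxf t x It Vx).
  exact: eq_on_near.
Qed.

Lemma Ck_timeS k f : Ck_time k.+1 f -> Ck_time k f.
Proof.
elim: k f => [|k IH] f; first by case.
case=> [cf [tf Ctf xf]]; split=> //; split=> //; first exact: IH.
by move=> i; have [dxf Cxf] := xf i; split=> //; apply: IH.
Qed.

Lemma Ck_time_cst k c : Ck_time k (fun _ _ => c).
Proof.
have cc : {within I `*` V, continuous (fun p : R * 'rV[R]_n => c)}.
  by move=> p; apply: cvg_cst.
elim: k c cc => [|k IH] c cc; split=> //.
have c0 : {within I `*` V, continuous (fun p : R * 'rV[R]_n => 0 : R)}.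
  by move=> p; apply: cvg_cst.
split.
- by move=> t x It Vx; apply: is_tderive_derivable (is_tderive_cst I c t).
- apply: Ck_time_eq (IH 0 c0) => t x It Vx.
  by rewrite (is_tderiveE I_interval I_interior It (is_tderive_cst I c t)).
- move=> i; split; first by move=> t x _ _; apply: derivable_cst.
  by apply: Ck_time_eq (IH 0 c0) => t x It Vx; rewrite /partial derive_cst.
Qed.

Lemma dtD f g t x : I t -> tderivable I (f^~ x) t -> tderivable I (g^~ x) t ->
  tderive I (fun s => f s x + g s x) t = tderive I (f^~ x) t + tderive I (g^~ x) t.
Proof.
move=> It tf tg; apply: (is_tderiveE I_interval I_interior It).
by apply: is_tderiveD; apply: tderivableP.
Qed.

Lemma dtM f g t x : I t -> tderivable I (f^~ x) t -> tderivable I (g^~ x) t ->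
  tderive I (fun s => f s x * g s x) t
  = tderive I (f^~ x) t * g t x + f t x * tderive I (g^~ x) t.
Proof.
move=> It tf tg; apply: (is_tderiveE I_interval I_interior It).
by apply: (is_tderiveM (f := f^~ x) (f' := g^~ x)); apply: tderivableP.
Qed.

Lemma dtV f t x : I t -> f t x != 0 -> tderivable I (f^~ x) t ->
  tderive I (fun s => (f s x)^-1) t
  = - tderive I (f^~ x) t * (f t x)^-1 * (f t x)^-1.
Proof.
move=> It f0 tf; apply: (is_tderiveE I_interval I_interior It).
by apply: (is_tderiveV (f := f^~ x)) => //; apply: tderivableP.
Qed.

Lemma Ck_timeD k f g : Ck_time k f -> Ck_time k g ->
  Ck_time k (fun t x => f t x + g t x).
Proof.
elim: k f g => [|k IH] f g [cf df] [cg dg].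
  by split=> // p; apply: cvgD; [exact: cf | exact: cg].
split; first by move=> p; apply: cvgD; [exact: cf | exact: cg].
case: df => [tf Ctf xf]; case: dg => [tg Ctg xg]; split.
- move=> t x It Vx; apply: is_tderive_derivable.
  by apply: is_tderiveD; apply: tderivableP; [exact: tf | exact: tg].
- apply: Ck_time_eq (IH _ _ Ctf Ctg) => t x It Vx.
  by rewrite dtD //; [exact: tf | exact: tg].
- move=> i; have [dxf Cxf] := xf i; have [dxg Cxg] := xg i; split.
    by move=> t x It Vx; apply: derivableD; [exact: dxf | exact: dxg].
  apply: Ck_time_eq (IH _ _ Cxf Cxg) => t x It Vx.
  by rewrite /partial -deriveD //; [exact: dxf | exact: dxg].
Qed.

Lemma Ck_timeM k f g : Ck_time k f -> Ck_time k g ->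
  Ck_time k (fun t x => f t x * g t x).
Proof.
elim: k f g => [|k IH] f g.
  by move=> [cf df] [cg dg]; split=> // p; apply: cvgM; [exact: cf | exact: cg].
move=> Cf Cg; have Cf' := Ck_timeS Cf; have Cg' := Ck_timeS Cg.
case: Cf => [cf [tf Ctf xf]]; case: Cg => [cg [tg Ctg xg]].
split; first by move=> p; apply: cvgM; [exact: cf | exact: cg].
split.
- move=> t x It Vx; apply: is_tderive_derivable.
  by apply: is_tderiveM; apply: tderivableP; [exact: tf | exact: tg].
- apply: Ck_time_eq (Ck_timeD (IH _ _ Ctf Cg') (IH _ _ Cf' Ctg)) => t x It Vx.
  by rewrite dtM //; [exact: tf | exact: tg].
- move=> i; have [dxf Cxf] := xf i; have [dxg Cxg] := xg i; split.
    by move=> t x It Vx; apply: derivableM; [exact: dxf | exact: dxg].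
  apply: Ck_time_eq (Ck_timeD (IH _ _ Cxf Cg') (IH _ _ Cf' Cxg)) => t x It Vx.
  rewrite /partial -[X in _ = 'D__ X _]/(f t * g t).
  rewrite deriveM; [|exact: dxf | exact: dxg].
  by rewrite addrC; congr (_ + _); rewrite mulrC.
Qed.

Lemma Ck_timeV k f : (forall t x, I t -> V x -> f t x != 0) -> Ck_time k f ->
  Ck_time k (fun t x => (f t x)^-1).
Proof.
move=> f0; elim: k f f0 => [|k IH] f f0 Cf.
  case: Cf => cf _; split=> //; apply/subspace_continuousP => -[t x] [It Vx].
  apply: cvgV; first exact: f0.
  by move/subspace_continuousP : cf => /(_ (t, x)); apply.
have CfV := IH _ f0 (Ck_timeS Cf).
have CfV2 := Ck_timeM CfV CfV.
case: Cf => [cf [tf Ctf xf]]; split.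
  apply/subspace_continuousP => -[t x] [It Vx].
  apply: cvgV; first exact: f0.
  by move/subspace_continuousP : cf => /(_ (t, x)); apply.
split.
- move=> t x It Vx; apply: is_tderive_derivable.
  by apply: is_tderiveV; [exact: f0 | apply: tderivableP; exact: tf].
- apply: Ck_time_eq (Ck_timeM (Ck_timeM (Ck_time_cst k (-1)) Ctf) CfV2) => t x It Vx.
  by rewrite dtV ?f0 //; [ring | exact: tf].
- move=> i; have [dxf Cxf] := xf i; split.
    by move=> t x It Vx; apply: derivableV; [exact: f0 | exact: dxf].
  apply: Ck_time_eq (Ck_timeM (Ck_timeM (Ck_time_cst k (-1)) Cxf) CfV2) => t x It Vx.
  rewrite /partial deriveV; [|exact: f0 | exact: dxf].
  by rewrite /GRing.scale /= expr2 invfM; ring.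
Qed.

End SmoothFunctions.

(** * Exchange of derivatives *)

(** The mean value theorem, applied in each variable, to the second
    difference of F over a rectangle. *)
Lemma rectangle_mvt (R : realType) (F Fa Fab : R -> R -> R) (a0 a1 b0 b1 : R) :
  a0 < a1 -> b0 < b1 ->
  (forall a b, a \in `[a0, a1] -> b \in `[b0, b1] ->
     is_derive a 1 (F^~ b) (Fa a b)) ->
  (forall a b, a \in `[a0, a1] -> b \in `[b0, b1] ->
     is_derive b 1 (Fa a) (Fab a b)) ->
  exists a b, [/\ a \in `[a0, a1], b \in `[b0, b1] &
    F a1 b1 - F a0 b1 - (F a1 b0 - F a0 b0) = Fab a b * (b1 - b0) * (a1 - a0)].
Proof.
move=> a01 b01 Fd Fad.
have oc (x y z : R) : z \in `]x, y[ -> z \in `[x, y] by apply: subset_itv_oo_cc.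
have b0i : b0 \in `[b0, b1] by rewrite in_itv /= lexx ltW.
have b1i : b1 \in `[b0, b1] by rewrite in_itv /= lexx ltW.
have dd a : a \in `[a0, a1] ->
    is_derive a 1 (fun a => F a b1 - F a b0) (Fa a b1 - Fa a b0).
  by move=> ai; apply: is_deriveB; apply: Fd.
have da a : a \in `]a0, a1[ ->
    is_derive a 1 (fun a => F a b1 - F a b0) (Fa a b1 - Fa a b0).
  by move=> ai; apply: dd; exact: oc.
have ca : {within `[a0, a1], continuous (fun a => F a b1 - F a b0)}.
  by apply: derivable_within_continuous => a ai; have [] := dd a ai.
have [a ai ea] := MVT a01 da ca.
have db b : b \in `]b0, b1[ -> is_derive b 1 (Fa a) (Fab a b).
  by move=> bi; apply: Fad; exact: oc.
have cb : {within `[b0, b1], continuous (Fa a)}.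
  by apply: derivable_within_continuous => b bi; have [] := Fad a b (oc _ _ _ ai) bi.
have [b bi eb] := MVT b01 db cb.
exists a, b; split; [exact: oc | exact: oc |].
by rewrite -eb -[RHS]ea; ring.
Qed.

Section Schwarz.
Variables (R : realType) (n : nat) (I : set R) (V : set 'rV[R]_n).
Hypothesis I_interval : is_interval I.
Hypothesis I_interior : interior I !=set0.
Hypothesis V_open : open V.
Implicit Types f : R -> 'rV[R]_n -> R.

(** A direction is a coordinate direction [Some i] or the time direction
    [None]; this treats both kinds of mixed derivatives at once. *)
Definition along (e : option 'I_n) (a : R) (p : R * 'rV[R]_n) :=
  if e is Some i then (p.1, a *: basis_vec R i + p.2) else (a + p.1, p.2).

Definition deriv_along (e : option 'I_n) f : R -> 'rV[R]_n -> R :=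
  if e is Some i then fun t => partial i (f t)
  else fun t x => tderive I (f^~ x) t.

Lemma along_comm e e' a a' p : along e a (along e' a' p) = along e' a' (along e a p).
Proof. by case: e => [i|]; case: e' => [j|] //=; rewrite addrCA. Qed.

Lemma is_tderive_interior (h : R -> R) t l :
  interior I t -> is_tderive I h t l -> is_derive t 1 h l.
Proof.
move=> It ht.
have e : (fun k => k^-1 *: ((h \o shift t) (k *: 1) - h t)) @ 0^' --> l.
  move=> U lU.
  have /= := filterI (ht U lU : nbhs t [set s | s != t -> I s -> U (tquot h t s)]) It.
  case=> r /= r0 rP; exists r => // k /= kr k0.
  have bk : ball t r (k + t).
    by move: kr; rewrite /ball /= sub0r opprD addrCA subrr addr0.
  have [h1 h2] := rP _ bk.
  have kt : k + t != t by rewrite -subr_eq0 addrK.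
  by have := h1 kt h2; rewrite /tquot addrK [k *: 1]mulr1.
apply: DeriveDef; first by apply/cvg_ex; exists l.
exact: cvg_lim.
Qed.

Lemma along_is_derive e f p a :
  let q := along e a p in
  interior I q.1 -> tderivable I (f^~ q.2) q.1 ->
  (forall i, derivable (f q.1) q.2 (basis_vec R i)) ->
  is_derive a 1 (fun a => f (along e a p).1 (along e a p).2)
            (deriv_along e f q.1 q.2).
Proof.
case: e => [i|] /= Iq tf df.
  have e : (fun k => k^-1 *: (((fun a => f p.1 (a *: basis_vec R i + p.2)) \o shift a)
                 (k *: 1) - f p.1 (a *: basis_vec R i + p.2))) =
     (fun k => k^-1 *: ((f p.1 \o shift (a *: basis_vec R i + p.2))
                 (k *: basis_vec R i) - f p.1 (a *: basis_vec R i + p.2))).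
    by apply: funext => k /=; rewrite [k *: 1]mulr1 scalerDl addrA.
  by split; [rewrite /derivable e; exact: df | rewrite /derive e].
have h : is_derive (a + p.1) 1 (f^~ p.2) (tderive I (f^~ p.2) (a + p.1)).
  by apply: is_tderive_interior => //; exact: tderivableP.
have e : (fun k => k^-1 *: (((fun a => f (a + p.1) p.2) \o shift a)
                 (k *: 1) - f (a + p.1) p.2)) =
     (fun k => k^-1 *: (((f^~ p.2) \o shift (a + p.1))
                 (k *: 1) - f (a + p.1) p.2)).
  by apply: funext => k /=; rewrite addrA.
by case: h => h1 h2; split; [rewrite /derivable e; exact: h1 | rewrite /derive e; exact: h2].
Qed.

(** It suffices to exchange derivatives at interior times, where the time
    derivative is two-sided. *)
Lemma interior_dense t (N : set R) : I t -> nbhs t N ->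
  exists2 s, N s & interior I s.
Proof.
move=> It [r /= r0 rN].
have oi (a b s : R) : a < s -> s < b -> (forall u, a < u -> u < b -> I u) -> interior I s.
  move=> as_ sb abI; have : s \in `]a, b[ by rewrite in_itv /= as_ sb.
  move=> /near_in_itvoo; apply: filterS => u.
  by rewrite in_itv /= => /andP[]; apply: abI.
case: (interval_one_sided I_interior It) => -[u tu Iu].
- pose s := Num.min ((t + u) / 2) (t + r / 2).
  have ts : t < s by rewrite lt_min; apply/andP; split; lra.
  have [sm sr] : s <= (t + u) / 2 /\ s <= t + r / 2 by rewrite !ge_min !lexx orbT.
  exists s.
    by apply: rN; rewrite /ball /= distrC gtr0_norm ?subr_gt0 //; lra.
  apply: (oi t u) => //; first by lra.
  by move=> v tv vu; apply: (I_interval It Iu); rewrite !ltW.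
- pose s := Num.max ((t + u) / 2) (t - r / 2).
  have st : s < t by rewrite gt_max; apply/andP; split; lra.
  have [sm sr] : (t + u) / 2 <= s /\ t - r / 2 <= s by rewrite !le_max !lexx orbT.
  exists s.
    by apply: rN; rewrite /ball /= gtr0_norm ?subr_gt0 //; lra.
  apply: (oi u t) => //; first by lra.
  by move=> v uv vt; apply: (I_interval Iu It); rewrite !ltW.
Qed.

Lemma pair_cvg (T : Type) (F : set_system T) (FF : Filter F)
    (U W : topologicalType) (f : T -> U) (h : T -> W) (a : U) (b : W) :
  f @ F --> a -> h @ F --> b -> (fun u => (f u, h u)) @ F --> (a, b).
Proof.
move=> fa hb N [[A B] /= [A0 B0] AB].
have FA : F (f @^-1` A) := fa A A0; have FB : F (h @^-1` B) := hb B B0.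
change (F ((fun u => (f u, h u)) @^-1` N)).
by apply: (filterS _ (filterI FA FB)) => u [Au Bu]; apply: AB.
Qed.

Lemma along_cvg (T : Type) (F : set_system T) (FF : Filter F) e
    (a : T -> R) (p : T -> R * 'rV[R]_n) a0 p0 :
  a @ F --> a0 -> p @ F --> p0 -> (fun u => along e (a u) (p u)) @ F --> along e a0 p0.
Proof.
move=> aa pp.
have p1 : (p u).1 @[u --> F] --> p0.1.
  move=> U U0; apply: (pp [set q | U q.1]).
  by exists (U, setT) => [|q []] //=; split=> //; exact: filterT.
have p2 : (p u).2 @[u --> F] --> p0.2.
  move=> U U0; apply: (pp [set q | U q.2]).
  by exists (setT, U) => [|q []] //=; split=> //; exact: filterT.
case: e => [i|] /=; apply: pair_cvg => //; last exact: cvgD.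
by apply: cvgD => //; apply: cvgZr_tmp.
Qed.

Lemma along_continuous e e' (p : R * 'rV[R]_n) :
  continuous (fun u : R * R => along e u.1 (along e' u.2 p)).
Proof.
move=> u; apply: along_cvg; first exact: cvg_fst.
by apply: along_cvg; [exact: cvg_snd | exact: cvg_cst].
Qed.

(** Arbitrarily close to (t, x) there are rectangles whose times are
    interior to I. On such a rectangle each of the two mixed derivatives
    takes somewhere the value of the normalised second difference of f. As
    both are continuous on I x V, up to the end points of I, they agree at
    (t, x). *)
Lemma schwarz e e' f t x : Ck_time 2 I V f -> I t -> V x ->
  deriv_along e (deriv_along e' f) t x = deriv_along e' (deriv_along e f) t x.
Proof.
move=> [cf [tf Ctf xf]] It Vx.
have dC d' : Ck_time 1 I V (deriv_along d' f).
  by case: d' => [i|]; [exact: (xf i).2 | exact: Ctf].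
have ddC d d' : {within I `*` V, continuous (fun p => deriv_along d (deriv_along d' f) p.1 p.2)}.
  have [cd [td Ctd xd]] := dC d'.
  by case: d => [i|]; [exact: (xd i).2.1 | exact: Ctd.1].
set g1 := deriv_along e _; set g2 := deriv_along e' _.
apply/eqP; apply: contraT => neq.
pose r := `|g1 t x - g2 t x| / 2.
have r0 : 0 < r by rewrite divr_gt0 // normr_gt0 subr_eq0.
have near1 : \forall p \near within (I `*` V) (nbhs (t, x)), `|g1 t x - g1 p.1 p.2| < r.
  have /subspace_continuousP/(_ (t, x) (conj It Vx)) := ddC e e'.
  by move/cvgrPdist_lt => /(_ _ r0).
have near2 : \forall p \near within (I `*` V) (nbhs (t, x)), `|g2 t x - g2 p.1 p.2| < r.
  have /subspace_continuousP/(_ (t, x) (conj It Vx)) := ddC e' e.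
  by move/cvgrPdist_lt => /(_ _ r0).
have : exists2 N, open_nbhs (t, x) N & forall p, N p -> I p.1 -> V p.2 ->
   `|g1 t x - g1 p.1 p.2| < r /\ `|g2 t x - g2 p.1 p.2| < r.
  have h : nbhs (t, x) [set p | (I `*` V) p ->
     `|g1 t x - g1 p.1 p.2| < r /\ `|g2 t x - g2 p.1 p.2| < r].
    exact: (filterI near1 near2).
  move: h; rewrite nbhsE => -[N oN NP].
  by exists N => // p Np Ip Vp; apply: (NP p Np).
case=> N [oN Ntx] NP.
(* move to an interior time, then choose a square around it *)
have [t' Nt' It'] : exists2 t', N (t', x) & interior I t'.
  apply: interior_dense It _.
  have := oN; rewrite openE => /(_ _ Ntx) [[A B] /= [At Bx] AB].
  by apply: filterS At => s As; apply: AB; split => //=; exact: nbhs_singleton.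
pose W := N `&` (interior I `*` V).
have nW : nbhs (t', x) W.
  apply: filterI; first exact: open_nbhs_nbhs.
  exists (interior I, V) => //; split; last exact: open_nbhs_nbhs.
  by apply: open_nbhs_nbhs; split => //; exact: open_interior.
pose phi (u : R * R) := along e u.1 (along e' u.2 (t', x)).
have phi0 : phi (0, 0) = (t', x).
  by rewrite /phi; case: (e) => [?|]; case: (e') => [?|] /=; rewrite ?scale0r ?add0r.
have [[A B] /= [A0 B0] AB] : nbhs (0, 0) (phi @^-1` W).
  by apply: along_continuous; rewrite -/(phi _) phi0.
have [s s0 sP] : exists2 s : R, 0 < s & forall a b, a \in `[0, s] -> b \in `[0, s] -> W (phi (a, b)).
  have := filterI A0 B0 => -[s /= s0 sAB]; exists (s / 2); first by rewrite divr_gt0.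
  have S c : c \in `[0, s / 2] -> A c /\ B c.
    rewrite in_itv /= => /andP[c0 cs]; apply: sAB.
    by rewrite /ball /= sub0r normrN ger0_norm //; lra.
  by move=> a b /S[Aa _] /S[_ Bb]; apply: AB; split.
have key d d' (q : R -> R -> R * 'rV[R]_n) :
    (forall a b, q a b = along d a (along d' b (t', x))) ->
    (forall a b, a \in `[0, s] -> b \in `[0, s] -> W (q a b)) ->
  exists a b, [/\ a \in `[0, s], b \in `[0, s] &
    f (q s s).1 (q s s).2 - f (q 0 s).1 (q 0 s).2 - (f (q s 0).1 (q s 0).2 - f (q 0 0).1 (q 0 0).2)
    = deriv_along d' (deriv_along d f) (q a b).1 (q a b).2 * (s - 0) * (s - 0)].
  move=> qE qW.
  apply: (rectangle_mvt (F := fun a b => f (q a b).1 (q a b).2)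
    (Fa := fun a b => deriv_along d f (q a b).1 (q a b).2)
    (Fab := fun a b => deriv_along d' (deriv_along d f) (q a b).1 (q a b).2)) => // a b ai bi.
  - have -> : (fun a => f (q a b).1 (q a b).2) =
       (fun a => f (along d a (along d' b (t', x))).1 (along d a (along d' b (t', x))).2).
      by apply: funext => a'; rewrite qE.
    have [_ [Iq Vq]] := qW a b ai bi.
    rewrite qE in Iq Vq *.
    apply: along_is_derive => //; first by apply: tf => //; exact: interior_subset.
    by move=> i; have [h _] := xf i; apply: h => //; exact: interior_subset.
  - have qE' a' b' : q a' b' = along d' b' (along d a' (t', x)) by rewrite qE along_comm.
    have -> : (fun b => deriv_along d f (q a b).1 (q a b).2) =
       (fun b => deriv_along d f (along d' b (along d a (t', x))).1 (along d' b (along d a (t', x))).2).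
      by apply: funext => a'; rewrite qE'.
    have [_ [Iq Vq]] := qW a b ai bi.
    rewrite qE' in Iq Vq *.
    have [_ [td Ctd xd]] := dC d.
    apply: along_is_derive => //; first by apply: td => //; exact: interior_subset.
    by move=> i; have [h _] := xd i; apply: h => //; exact: interior_subset.
have [a [b [ai bi E1]]] := key e' e (fun a b => phi (b, a))
  (fun a b => along_comm _ _ _ _ _) (fun a b ai bi => sP b a bi ai).
have [a' [b' [ai' bi' E2]]] := key e e' (fun a b => phi (a, b))
  (fun a b => erefl) sP.
have E : g1 (phi (b, a)).1 (phi (b, a)).2 = g2 (phi (a', b')).1 (phi (a', b')).2.
  apply: (@mulIf _ ((s - 0) * (s - 0))); first by rewrite mulf_neq0 // subr0 gt_eqF.
  by rewrite !mulrA -E1 -E2; ring.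
have [Np [Ip Vp]] := sP b a bi ai; have [Np' [Ip' Vp']] := sP a' b' ai' bi'.
have [d1 _] := NP _ Np (interior_subset Ip) Vp.
have [_ d2] := NP _ Np' (interior_subset Ip') Vp'.
have : `|g1 t x - g2 t x| < r + r.
  rewrite E in d1.
  have -> : g1 t x - g2 t x = (g1 t x - g2 (phi (a', b')).1 (phi (a', b')).2)
     - (g2 t x - g2 (phi (a', b')).1 (phi (a', b')).2) by ring.
  by apply: le_lt_trans (ler_normB _ _) _; apply: ltrD.
by rewrite /r -splitr ltxx.
Qed.

End Schwarz.

(** * The differential ring of smooth functions *)

Record spacetime (R : realType) (n : nat) := Spacetime {
  times : set R;
  space : set 'rV[R]_n;
  times_interval : is_interval times;
  times_interior : interior times !=set0;
  space_open : open space
}.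

(** Elements of the ring are functions on the domain alone, so that
    equality in the ring is equality of values on the domain; derivatives
    are taken after extension by zero, which changes nothing as V is open
    and time derivatives are taken within I. *)
Definition event (R : realType) (n : nat) (D : spacetime R n) : Type :=
  {p : R * 'rV[R]_n | times D p.1 /\ space D p.2}.

Section SmoothFunctionRing.
Variables (R : realType) (n : nat) (D : spacetime R n).
Local Notation I := (times D).
Local Notation V := (space D).
Implicit Types u v : event D -> R.

Definition extend u (t : R) (x : 'rV[R]_n) : R :=
  if pselect (I t /\ V x) is left H then u (exist _ (t, x) H) else 0.

Definition on_events (F : R -> 'rV[R]_n -> R) : event D -> R :=
  fun p => F (sval p).1 (sval p).2.

Lemma extendE u t x (H : I t /\ V x) : extend u t x = u (exist _ (t, x) H).
Proof.
by rewrite /extend; case: pselect => // H'; rewrite (Prop_irrelevance H H').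
Qed.

Lemma on_eventsK F : eq_on I V F (extend (on_events F)).
Proof. by move=> t x It Vx; rewrite (extendE _ (conj It Vx)). Qed.

Definition smooth_pred : pred (event D -> R) :=
  fun u => `[< smooth_time I V (extend u) >].

Let TI := @times_interval R n D.
Let TN := @times_interior R n D.
Let SO := @space_open R n D.

Lemma smooth_time_eq F G : eq_on I V F G -> smooth_time I V F -> smooth_time I V G.
Proof.
by move=> e sF k; apply: (Ck_time_eq SO e); exact: sF.
Qed.

Lemma smooth_pred_subring : subring_closed smooth_pred.
Proof.
split.
- apply/asboolP; apply: (smooth_time_eq (F := fun _ _ => 1)).
    by move=> t x It Vx; rewrite (extendE _ (conj It Vx)).
  by move=> k; apply: (Ck_time_cst TI TN SO).
- move=> u v /asboolP su /asboolP sv; apply/asboolP.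
  apply: (smooth_time_eq (F := fun t x => extend u t x + -1 * extend v t x)).
    by move=> t x It Vx; rewrite !(extendE _ (conj It Vx)) mulN1r.
  move=> k; apply: (Ck_timeD TI TN SO); first exact: su.
  by apply: (Ck_timeM TI TN SO); [exact: (Ck_time_cst TI TN SO) | exact: sv].
- move=> u v /asboolP su /asboolP sv; apply/asboolP.
  apply: (smooth_time_eq (F := fun t x => extend u t x * extend v t x)).
    by move=> t x It Vx; rewrite !(extendE _ (conj It Vx)).
  by move=> k; apply: (Ck_timeM TI TN SO); [exact: su | exact: sv].
Qed.

HB.instance Definition _ := GRing.isSubringClosed.Build (event D -> R)
  smooth_pred smooth_pred_subring.

Record smooth_fun := SmoothFun {
  smooth_val : event D -> R;
  smooth_valP : smooth_val \in smooth_pred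
}.

HB.instance Definition _ := [isSub for smooth_val].
HB.instance Definition _ := [Choice of smooth_fun by <:].
HB.instance Definition _ := GRing.SubChoice_isSubComPzRing.Build
  (event D -> R) smooth_pred smooth_fun smooth_pred_subring.

Definition to_fun (f : smooth_fun) : R -> 'rV[R]_n -> R := extend (smooth_val f).

Lemma to_fun_smooth f : smooth_time I V (to_fun f).
Proof. exact: asboolW (smooth_valP f). Qed.

Lemma smooth_pred_on_events F : smooth_time I V F -> on_events F \in smooth_pred.
Proof.
by move=> sF; apply/asboolP; apply: smooth_time_eq sF; exact: on_eventsK.
Qed.

Definition mk_smooth F (sF : smooth_time I V F) : smooth_fun :=
  SmoothFun (smooth_pred_on_events sF).

Lemma to_fun_mk F (sF : smooth_time I V F) : eq_on I V (to_fun (mk_smooth sF)) F.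
Proof. by move=> t x It Vx; rewrite /to_fun -on_eventsK. Qed.

Lemma smooth_fun_eq (f g : smooth_fun) : eq_on I V (to_fun f) (to_fun g) -> f = g.
Proof.
move=> e; apply: val_inj; apply: funext => -[[t x] H].
by have := e t x H.1 H.2; rewrite /to_fun !(extendE _ H).
Qed.

Lemma to_funD f g : eq_on I V (to_fun (f + g)) (fun t x => to_fun f t x + to_fun g t x).
Proof. by move=> t x It Vx; rewrite /to_fun !(extendE _ (conj It Vx)). Qed.

Lemma to_funM f g : eq_on I V (to_fun (f * g)) (fun t x => to_fun f t x * to_fun g t x).
Proof. by move=> t x It Vx; rewrite /to_fun !(extendE _ (conj It Vx)). Qed.

Lemma smooth_deriv_along e F : smooth_time I V F -> smooth_time I V (deriv_along I e F).
Proof.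
move=> sF k; have [_ [_ Ct Cx]] := sF k.+1.
by case: e => [i|] /=; [exact: (Cx i).2 | exact: Ct].
Qed.

Definition der (e : option 'I_n) (f : smooth_fun) : smooth_fun :=
  mk_smooth (smooth_deriv_along e (to_fun_smooth f)).

Lemma to_fun_der e f : eq_on I V (to_fun (der e f)) (deriv_along I e (to_fun f)).
Proof. exact: to_fun_mk. Qed.

Lemma eq_deriv_along e F G : eq_on I V F G ->
  eq_on I V (deriv_along I e F) (deriv_along I e G).
Proof. by case: e => [i|] E; [exact: (eq_dx SO) | exact: eq_dt]. Qed.

Let tder f t x : I t -> V x -> tderivable I ((to_fun f)^~ x) t.
Proof. by have [_ [h _ _]] := to_fun_smooth f 1; exact: h. Qed.
Let xder f i t x : I t -> V x -> derivable (to_fun f t) x (basis_vec R i).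
Proof. by have [_ [_ _ h]] := to_fun_smooth f 1; exact: (h i).1. Qed.

Lemma der_derivation e : derivation (der e).
Proof.
split=> f g; apply: smooth_fun_eq => t x It Vx.
- rewrite to_fun_der // (eq_deriv_along _ (to_funD f g)) // to_funD // !to_fun_der //.
  case: e => [i|] /=.
    by rewrite /partial -deriveD //; exact: xder.
  by rewrite (dtD TI TN) //; exact: tder.
- rewrite to_fun_der // (eq_deriv_along _ (to_funM f g)) // to_funD // !to_funM // !to_fun_der //.
  case: e => [i|] /=.
    rewrite /partial -[X in 'D__ X _ = _]/(to_fun f t * to_fun g t).
    rewrite deriveM; try exact: xder.
    by rewrite addrC; congr (_ + _); rewrite mulrC.
  by rewrite (dtM TI TN) //; exact: tder.
Qed.

Lemma der_comm e e' f : der e (der e' f) = der e' (der e f).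
Proof.
apply: smooth_fun_eq => t x It Vx.
rewrite to_fun_der // (eq_deriv_along _ (to_fun_der e' f)) //.
rewrite [RHS]to_fun_der // (eq_deriv_along _ (to_fun_der e f)) //.
by apply: (schwarz TI TN SO) => //; exact: to_fun_smooth.
Qed.

Lemma smooth_fun_inv f : (forall t x, I t -> V x -> to_fun f t x != 0) ->
  exists h, f * h = 1.
Proof.
move=> f0.
have sh : smooth_time I V (fun t x => (to_fun f t x)^-1).
  by move=> k; apply: (Ck_timeV TI TN SO f0); exact: to_fun_smooth.
exists (mk_smooth sh); apply: smooth_fun_eq => t x It Vx.
rewrite to_funM // to_fun_mk // mulfV ?f0 //.
by rewrite /to_fun (extendE _ (conj It Vx)).
Qed.

End SmoothFunctionRing.

(** * Curvature in coordinates *)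

Section CoordinateCurvature.
Variables (R : realType) (n : nat) (G : 'rV[R]_n -> 'M[R]_n).

Lemma partial_cst (i : 'I_n) (a : R) x : partial i (fun=> a) x = 0.
Proof. exact: derive_cst. Qed.

Lemma frameE (i j : 'I_n) (x : 'rV[R]_n) : frame i x 0 j = (i == j)%:R.
Proof. by rewrite /frame /basis_vec mxE eqxx eq_sym. Qed.

Lemma nabla_vf_frame (Y : 'rV[R]_n -> 'rV[R]_n) (i k : 'I_n) (x : 'rV[R]_n) :
  nabla_vf G (frame i) Y x 0 k =
  partial i (fun y => Y y 0 k) x + \sum_j christoffel G k i j x * Y x 0 j.
Proof.
rewrite mxE; under eq_bigr do rewrite frameE.
exact: (sum_delta i (fun m => partial m (fun y => Y y 0 k) x
  + \sum_j christoffel G k m j x * Y x 0 j)).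
Qed.

Lemma nabla_frame_frame (i j k : 'I_n) (x : 'rV[R]_n) :
  nabla_vf G (frame i) (frame j) x 0 k = christoffel G k i j x.
Proof.
rewrite nabla_vf_frame partial_cst add0r.
rewrite -[RHS](sum_delta j (fun m => christoffel G k i m x)).
by apply: eq_bigr => m _; rewrite frameE mulrC.
Qed.

Lemma lie_bracket_frame (i j : 'I_n) (x : 'rV[R]_n) : lie_bracket (frame i) (frame j) x = 0.
Proof.
apply/rowP => k; rewrite mxE [RHS]mxE big1 // => m _.
by rewrite !partial_cst !mulr0 subrr.
Qed.

(** The coordinate fields commute, and nabla_(d_i) d_k has the Christoffel
    symbols as its components. *)
Lemma riem_upE (l i j k : 'I_n) (x : 'rV[R]_n) : riem_up G l i j k x =
  partial j (christoffel G l i k) x - partial i (christoffel G l j k) x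
  + \sum_m (christoffel G m i k x * christoffel G l j m x
            - christoffel G m j k x * christoffel G l i m x).
Proof.
rewrite /riem_up /riem_op mxE [X in X + _]mxE [X in _ + X + _]mxE.
rewrite [in X in _ + X]/nabla_vf [X in _ + X]mxE.
under [X in _ + X]eq_bigr do rewrite lie_bracket_frame mxE mul0r.
rewrite big1 // addr0 !nabla_vf_frame.
have E (a b : 'I_n) : (fun y => nabla_vf G (frame a) (frame b) y 0 l) = christoffel G l a b.
  by apply: funext => y; rewrite nabla_frame_frame.
rewrite !E sumrB opprD.
rewrite addrACA; congr (_ + (_ - _)); apply: eq_bigr => m _;
  by rewrite nabla_frame_frame mulrC.
Qed.

End CoordinateCurvature.

Section Representation.
Variables (R : realType) (n : nat) (D : spacetime R n).
Local Notation A := (smooth_fun D).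
Local Notation I := (times D).
Local Notation V := (space D).

(** The transfer from the ring to functions on space-time. The metric below
    is any family of matrices, so that each coordinate expression is
    represented as soon as the metric and its inverse are. *)
Definition represents (f : A) (F : R -> 'rV[R]_n -> R) : Prop := eq_on I V (to_fun f) F.

Definition ev_at (w : event D) (f : A) : R := smooth_val f w.

Lemma ev_at_zmod w : zmod_morphism (ev_at w). Proof. by []. Qed.
Lemma ev_at_monoid w : monoid_morphism (ev_at w). Proof. by []. Qed.
Lemma ev_at0 w : ev_at w 0 = 0. Proof. by []. Qed.
Lemma ev_atD w f h : ev_at w (f + h) = ev_at w f + ev_at w h. Proof. by []. Qed.
Lemma ev_atN w f : ev_at w (- f) = - ev_at w f. Proof. by []. Qed.
Lemma ev_atM w f h : ev_at w (f * h) = ev_at w f * ev_at w h. Proof. by []. Qed.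
HB.instance Definition _ w := GRing.isZmodMorphism.Build A R (ev_at w) (ev_at_zmod w).
HB.instance Definition _ w := GRing.isMonoidMorphism.Build A R (ev_at w) (ev_at_monoid w).

Lemma repP f F : represents f F <-> forall w : event D, ev_at w f = F (sval w).1 (sval w).2.
Proof.
split=> [rf [[t x] H]|ef t x It Vx]; last first.
  by rewrite /to_fun (extendE _ (conj It Vx)) -[LHS]/(ev_at _ f) ef.
by rewrite -(rf t x H.1 H.2) /to_fun (extendE _ H).
Qed.

Lemma repD f g F G : represents f F -> represents g G -> represents (f + g) (fun t x => F t x + G t x).
Proof. by move=> /repP rf /repP rg; apply/repP => w; rewrite ev_atD rf rg. Qed.

Lemma repN f F : represents f F -> represents (- f) (fun t x => - F t x).
Proof. by move=> /repP rf; apply/repP => w; rewrite ev_atN rf. Qed.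

Lemma repB f g F G : represents f F -> represents g G -> represents (f - g) (fun t x => F t x - G t x).
Proof. by move=> rf rg; apply: repD => //; apply: repN. Qed.

Lemma repM f g F G : represents f F -> represents g G -> represents (f * g) (fun t x => F t x * G t x).
Proof. by move=> /repP rf /repP rg; apply/repP => w; rewrite ev_atM rf rg. Qed.

Lemma rep_sum (f : 'I_n -> A) F : (forall i, represents (f i) (F i)) ->
  represents (\sum_i f i) (fun t x => \sum_i F i t x).
Proof.
move=> rf; apply/repP => w.
rewrite (big_morph (ev_at w) (ev_atD w) (ev_at0 w)); apply: eq_bigr => i _.
by have /repP -> := rf i.
Qed.

Lemma rep_der e f F : represents f F -> represents (der e f) (deriv_along I e F).
Proof.
move=> rf t x It Vx; rewrite to_fun_der //.
by rewrite (eq_deriv_along _ rf).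
Qed.

Lemma rep_eq f F F' : eq_on I V F F' -> represents f F -> represents f F'.
Proof. by move=> e rf t x It Vx; rewrite rf // e. Qed.

Definition cst_smooth (a : R) : A :=
  mk_smooth (fun k => Ck_time_cst (@times_interval R n D) (@times_interior R n D)
                        (@space_open R n D) k a).

Lemma rep_cst a : represents (cst_smooth a) (fun _ _ => a).
Proof. exact: to_fun_mk. Qed.

Section Geometry.
Variable G : R -> 'rV[R]_n -> 'M[R]_n.
Variables g gi : 'I_n -> 'I_n -> A.
Hypothesis gP : forall i j, represents (g i j) (fun t x => G t x i j).
Hypothesis giP : forall i j, represents (gi i j) (fun t x => ginv (G t) i j x).
Local Notation d := (fun i : 'I_n => der (D := D) (Some i)).
Local Notation half := (cst_smooth 2^-1).
Local Notation Gam := (levi d g gi half).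

Lemma rep_levi p i m : represents (Gam p i m) (fun t => christoffel (G t) m p i).
Proof.
apply: repM; first exact: rep_cst.
apply: rep_sum => l; apply: repM => //.
by apply: repB; [apply: repD|]; apply: (@rep_der (Some _)); exact: gP.
Qed.

Lemma rep_curv i j k l : represents (curv d Gam i j k l) (fun t => riem_up (G t) l i j k).
Proof.
apply: (rep_eq (F := fun t x =>
  partial j (christoffel (G t) l i k) x - partial i (christoffel (G t) l j k) x
  + \sum_m (christoffel (G t) m i k x * christoffel (G t) l j m x
            - christoffel (G t) m j k x * christoffel (G t) l i m x))).
  by move=> t x It Vx; rewrite riem_upE.
apply: repD.
  by apply: repB; apply: (@rep_der (Some _)); exact: rep_levi.
by apply: rep_sum => m; apply: repB; apply: repM; exact: rep_levi.
Qed.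

Lemma rep_riem i j k l : represents (riemann d g gi half i j k l) (fun t => riem (G t) i j k l).
Proof. by apply: rep_sum => m; apply: repM; [exact: gP | exact: rep_curv]. Qed.

Lemma rep_tr f F : (forall i j, represents (f i j) (F i j)) ->
  represents (tr gi f) (fun t x => \sum_i \sum_j ginv (G t) i j x * F i j t x).
Proof.
by move=> rf; apply: rep_sum => i; apply: rep_sum => j; apply: repM.
Qed.

Lemma rep_ric i k : represents (ric gi (riemann d g gi half) i k) (fun t => ricci (G t) i k).
Proof. by apply: rep_tr => j l; exact: rep_riem. Qed.

Lemma rep_scal : represents (tr gi (ric gi (riemann d g gi half))) (fun t => scal (G t)).
Proof. by apply: rep_tr => j l; exact: rep_ric. Qed.

Variables x y : A.
Hypothesis xP : represents x (fun _ _ => (n%:R - 2)^-1).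
Hypothesis yP : represents y (fun _ _ => (n%:R - 1)^-1).
Local Notation W := (weyl_of g gi x y (riemann d g gi half)).

Lemma rep_weyl i j k l : represents (W i j k l) (fun t => weyl (G t) i j k l).
Proof.
apply: (rep_eq (F := fun t z =>
  riem (G t) i j k l z + scal (G t) z * ((n%:R - 2)^-1 * (n%:R - 1)^-1)
     * (G t z i k * G t z j l - G t z i l * G t z j k)
  - (n%:R - 2)^-1 *
    (ricci (G t) i k z * G t z j l - ricci (G t) i l z * G t z j k
     + ricci (G t) j l z * G t z i k - ricci (G t) j k z * G t z i l))).
  by move=> t z _ _; rewrite /weyl [(n%:R - 1) * _]mulrC invfM.
apply: repB; last first.
  apply: repM => //; apply: repB; [apply: repD; [apply: repB|]|];
    by apply: repM; [exact: rep_ric|exact: gP].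
apply: repD; first exact: rep_riem.
apply: repM; last by apply: repB; apply: repM; exact: gP.
by apply: repM; [exact: rep_scal | apply: repM].
Qed.

Lemma rep_quad i j k l : represents (quad gi W W i j k l) (fun t => weylD (G t) i j k l).
Proof.
apply: (rep_eq (F := fun t z => \sum_p \sum_q ginv (G t) p q z *
  \sum_r \sum_s ginv (G t) r s z * (weyl (G t) p i j r z * weyl (G t) s l k q z))).
  move=> t z _ _; apply: eq_bigr => p _; apply: eq_bigr => q _.
  rewrite big_distrr; apply: eq_bigr => r _ /=.
  by rewrite big_distrr; apply: eq_bigr => s _ /=; rewrite !mulrA.
apply: rep_tr => p q; apply: (rep_tr (F := fun r s t z => weyl (G t) p i j r z * weyl (G t) s l k q z)) => r s.
by apply: repM; exact: rep_weyl.
Qed.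

Lemma rep_nabla4 (T : 'I_n -> 'I_n -> 'I_n -> 'I_n -> A) T'
    (TP : forall i j k l, represents (T i j k l) (fun t => T' t i j k l)) p i j k l :
  represents (nabla d Gam (tens4 T) [:: p; i; j; k; l])
      (fun t => nabla4 (G t) (T' t) p i j k l).
Proof.
apply: (rep_eq (F := fun t z => partial p (T' t i j k l) z
  - \sum_m christoffel (G t) m p l z * T' t i j k m z
  - \sum_m christoffel (G t) m p k z * T' t i j m l z
  - \sum_m christoffel (G t) m p j z * T' t i m k l z
  - \sum_m christoffel (G t) m p i z * T' t m j k l z)).
  by move=> t z _ _; rewrite /nabla4 !big_split /=; ring.
do 4 (apply: repB; last by apply: rep_sum => m; apply: repM; [exact: rep_levi | exact: TP]).
exact: (rep_der (Some p) (TP i j k l)).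
Qed.

Lemma rep_nabla5 (T : seq 'I_n -> A) T'
    (TP : forall q i j k l, represents (T [:: q; i; j; k; l]) (fun t => T' t q i j k l)) p q i j k l :
  represents (nabla d Gam T [:: p; q; i; j; k; l])
      (fun t => nabla5 (G t) (T' t) p q i j k l).
Proof.
apply: (rep_eq (F := fun t z => partial p (T' t q i j k l) z
  - \sum_m christoffel (G t) m p l z * T' t q i j k m z
  - \sum_m christoffel (G t) m p k z * T' t q i j m l z
  - \sum_m christoffel (G t) m p j z * T' t q i m k l z
  - \sum_m christoffel (G t) m p i z * T' t q m j k l z
  - \sum_m christoffel (G t) m p q z * T' t m i j k l z)).
  by move=> t z _ _; rewrite /nabla5 !big_split /=; ring.
do 5 (apply: repB; last by apply: rep_sum => m; apply: repM; [exact: rep_levi | exact: TP]).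
exact: (rep_der (Some p) (TP q i j k l)).
Qed.

Lemma rep_laplacian_weyl i j k l :
  represents (laplacian d g gi half (tens4 W) [:: i; j; k; l])
      (fun t => rough_laplacian (G t) (weyl (G t)) i j k l).
Proof.
apply: (rep_tr (F := fun p q t =>
  nabla5 (G t) (nabla4 (G t) (weyl (G t))) p q i j k l)) => p q.
apply: (rep_nabla5 (T' := fun t => nabla4 (G t) (weyl (G t)))) => *.
by apply: (rep_nabla4 (T' := fun t => weyl (G t))) => *; exact: rep_weyl.
Qed.

Lemma rep_ric_norm2 :
  represents (inner2 gi (ric gi (riemann d g gi half)) (ric gi (riemann d g gi half)))
      (fun t => ricci_norm2 (G t)).
Proof.
apply: (rep_eq (F := fun t z => \sum_p \sum_q ginv (G t) p q z *
  \sum_r \sum_s ginv (G t) r s z * (ricci (G t) p r z * ricci (G t) q s z))).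
  move=> t z _ _; apply: eq_bigr => p _; rewrite exchange_big; apply: eq_bigr => r _ /=.
  rewrite big_distrr; apply: eq_bigr => s _ /=.
  rewrite big_distrr; apply: eq_bigr => s' _ /=; ring.
apply: rep_tr => p q; apply: (rep_tr (F := fun r s t z => ricci (G t) p r z * ricci (G t) q s z)) => r s.
by apply: repM; exact: rep_ric.
Qed.

Lemma rep_ric_act i j k l :
  represents (ric_act gi (ric gi (riemann d g gi half)) W i j k l)
      (fun t z => \sum_p \sum_q ginv (G t) p q z *
        (ricci (G t) i p z * weyl (G t) q j k l z + ricci (G t) j p z * weyl (G t) i q k l z
         + ricci (G t) k p z * weyl (G t) i j q l z + ricci (G t) l p z * weyl (G t) i j k q z)).
Proof.
apply: (rep_tr (F := fun p q t z => ricci (G t) i p z * weyl (G t) q j k l z + ricci (G t) j p z * weyl (G t) i q k l z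
         + ricci (G t) k p z * weyl (G t) i j q l z + ricci (G t) l p z * weyl (G t) i j k q z)) => p q.
by do ?apply: repD; apply: repM; first [exact: rep_ric | exact: rep_weyl].
Qed.

Lemma rep_ric_square i k :
  represents (prod2 gi (ric gi (riemann d g gi half)) (ric gi (riemann d g gi half)) i k)
      (fun t z => tr (fun p q => ginv (G t) p q z)
                     (fun p q => ricci (G t) i p z * ricci (G t) q k z)).
Proof.
apply: (rep_tr (F := fun p q t z => ricci (G t) i p z * ricci (G t) q k z)) => p q.
by apply: repM; exact: rep_ric.
Qed.

Lemma rep_wedge (u v : 'I_n -> 'I_n -> A) (U V' : 'I_n -> 'I_n -> R -> 'rV[R]_n -> R) i j k l :
  (forall a b, represents (u a b) (U a b)) -> (forall a b, represents (v a b) (V' a b)) ->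
  represents (wedge u v i j k l) (fun t z => U i k t z * V' j l t z - U i l t z * V' j k t z).
Proof. by move=> uP vP; apply: repB; apply: repM. Qed.

Lemma rep_kn (u v : 'I_n -> 'I_n -> A) (U V' : 'I_n -> 'I_n -> R -> 'rV[R]_n -> R) i j k l :
  (forall a b, represents (u a b) (U a b)) -> (forall a b, represents (v a b) (V' a b)) ->
  represents (kn u v i j k l) (fun t z => U i k t z * V' j l t z - U i l t z * V' j k t z
     + U j l t z * V' i k t z - U j k t z * V' i l t z).
Proof.
by move=> uP vP; apply: repB; [apply: repD; [apply: repB|]|]; apply: repM.
Qed.

End Geometry.

Lemma rep_nat m : represents (m%:R : A) (fun _ _ => m%:R).
Proof. by apply/repP => w; rewrite rmorph_nat. Qed.

End Representation.

(** * The metric as an element of the ring *)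

Section Metric.
Variables (R : realType) (n : nat) (D : spacetime R n).
Local Notation A := (smooth_fun D).
Local Notation I := (times D).
Local Notation V := (space D).
Variable G : R -> 'rV[R]_n -> 'M[R]_n.
Hypothesis G_smooth : forall i j, smooth_time I V (fun t x => G t x i j).
Hypothesis G_sym : forall t x, I t -> V x -> (G t x)^T = G t x.
Hypothesis G_posdef : forall t x, I t -> V x ->
  forall v : 'rV[R]_n, v != 0 -> 0 < (v *m G t x *m v^T) 0 0.

Lemma posdef_unit t x : I t -> V x -> G t x \in unitmx.
Proof.
move=> It Vx; rewrite -row_free_unit -kermx_eq0; apply/eqP/row_matrixP => i.
rewrite row0; apply/eqP; apply: contraT => v0.
have := G_posdef It Vx v0.
have /sub_kermxP -> : (row i (kermx (G t x)) <= kermx (G t x))%MS by exact: row_sub.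
by rewrite mul0mx mxE ltxx.
Qed.

Definition metric_fun (i j : 'I_n) : A := mk_smooth (G_smooth i j).

(** By Cramer's rule, as the determinant vanishes nowhere and is therefore
    invertible in the ring. *)
Lemma metric_inverse : exists gi : 'I_n -> 'I_n -> A,
  [/\ forall i j, represents (gi i j) (fun t x => ginv (G t) i j x),
      forall i j, gi i j = gi j i &
      forall i j, \sum_k gi i k * metric_fun k j = (i == j)%:R].
Proof.
pose M : 'M[A]_n := \matrix_(i, j) metric_fun i j.
have MP w : map_mx (ev_at w) M = G (sval w).1 (sval w).2.
  by apply/matrixP => i j; rewrite !mxE.
have [h hP] : exists h, \det M * h = 1.
  apply: smooth_fun_inv => t x It Vx.
  have -> : to_fun (\det M) t x = \det (G t x).
    rewrite /to_fun (extendE _ (conj It Vx)) -[LHS]/(ev_at _ (\det M)).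
    by rewrite -det_map_mx MP.
  by have := posdef_unit It Vx; rewrite unitmxE unitfE.
pose gi i j := h * (\adj M) i j.
have giP i j : represents (gi i j) (fun t x => ginv (G t) i j x).
  apply/repP => w; have [It Vx] := svalP w.
  rewrite /ginv /invmx (posdef_unit It Vx) mxE /gi.
  transitivity (ev_at w h * ev_at w ((\adj M) i j)); first by [].
  have -> : ev_at w ((\adj M) i j) = (\adj (G (sval w).1 (sval w).2)) i j.
    by rewrite -MP -map_mx_adj [RHS]mxE.
  congr (_ * _).
  have := congr1 (ev_at w) hP; rewrite ev_atM -det_map_mx MP => e.
  have d0 : \det (G (sval w).1 (sval w).2) != 0.
    by have := posdef_unit It Vx; rewrite unitmxE unitfE.
  by apply: (mulfI d0); rewrite e mulfV.
exists gi; split=> // i j.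
  apply: smooth_fun_eq => t x It Vx; rewrite !giP // /ginv.
  by rewrite -[in RHS](G_sym It Vx) -trmx_inv mxE.
rewrite /gi; under eq_bigr do rewrite -mulrA.
rewrite -big_distrr /=.
have -> : \sum_k (\adj M) i k * metric_fun k j = \det M *+ (i == j).
  transitivity ((\adj M *m M) i j); last by rewrite mul_adj_mx mxE.
  by rewrite [RHS]mxE; apply: eq_bigr => k _; rewrite [M k j]mxE.
by rewrite mulrnAr mulrC hP.
Qed.

End Metric.

(** * The evolution equation *)

Lemma kn_square_expand (A : comPzRingType) (n : nat) (gu r gd : 'I_n -> 'I_n -> A)
    (i j k l : 'I_n) :
  \sum_p \sum_q gu p q *
    (r i p * r q k * gd j l - r i p * r q l * gd j k
     + r j p * r q l * gd i k - r j p * r q k * gd i l)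
  = kn (prod2 gu r r) gd i j k l.
Proof. by rewrite /kn -!trZr -trB -trD -trB. Qed.

Lemma collect_coefficients (F : fieldType) (N : F) (D1 D2 D3 D4 a P1 P2 P3 P4 r1 r2 r3 r4 g1 g2 g3 g4 S B : F) :
  N - 1 != 0 -> N - 2 != 0 ->
  2 * (D1 - D2 + D3 - D4) - a
  + 2 * ((N - 2)^-1 * (N - 2)^-1) * (P1 * g3 - P2 * g4 + P3 * g1 - P4 * g2)
  - 2 * S * ((N - 2)^-1 * (N - 2)^-1) * (r1 * g3 - r2 * g4 + r3 * g1 - r4 * g2)
  + 2 * (N - 2)^-1 * (r1 * r3 - r2 * r4)
  + 2 * (S * S - B) * ((N - 1)^-1 * ((N - 2)^-1 * (N - 2)^-1)) * (g1 * g3 - g2 * g4)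
  = 2 * (D1 - D2 + D3 - D4) - a
  + 2 / (N - 2) ^+ 2 * (P1 * g3 - P2 * g4 + P3 * g1 - P4 * g2)
  - 2 * S / (N - 2) ^+ 2 * (r1 * g3 - r2 * g4 + r3 * g1 - r4 * g2)
  + 2 / (N - 2) * (r1 * r3 - r4 * r2)
  + 2 * (S ^+ 2 - B) / ((N - 1) * (N - 2) ^+ 2) * (g1 * g3 - g2 * g4).
Proof. by move=> N1 N2; field; rewrite N1 N2. Qed.

Unset Implicit Arguments.

Theorem proposition1p1 (R : realType) (n : nat) (hn : (3 <= n)%N)
  (M : smooth_manifold R n)
  (I : set R) (I_interval : is_interval I) (I_interior : interior I !=set0)
  (g : metric_family M I) (hflow : ricci_flow g)
  (c : chart M) (t : R) (x : 'rV[R]_n) (ht : I t) (hx : chart_image c x)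
  (i j k l : 'I_n) :
  let G := g c t in
  let gd a b := G x a b in
  let gu a b := ginv G a b x in
  let Ric a b := ricci G a b x in
  let S := scal G x in
  let W a b d e := weyl G a b d e x in
  let D a b d e := weylD G a b d e x in
  let N : R := n%:R in
  tderive I (fun s => weyl (g c s) i j k l x) t
    - rough_laplacian G (weyl G) i j k l x
  = 2 * (D i j k l - D i j l k + D i k j l - D i l j k)
    - \sum_p \sum_q gu p q *
        (Ric i p * W q j k l + Ric j p * W i q k l
         + Ric k p * W i j q l + Ric l p * W i j k q)
    + 2 / (N - 2) ^+ 2 *
        (\sum_p \sum_q gu p q *
          (Ric i p * Ric q k * gd j l - Ric i p * Ric q l * gd j k
           + Ric j p * Ric q l * gd i k - Ric j p * Ric q k * gd i l))
    - 2 * S / (N - 2) ^+ 2 *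
        (Ric i k * gd j l - Ric i l * gd j k
         + Ric j l * gd i k - Ric j k * gd i l)
    + 2 / (N - 2) * (Ric i k * Ric j l - Ric j k * Ric i l)
    + 2 * (S ^+ 2 - ricci_norm2 G x) / ((N - 1) * (N - 2) ^+ 2) *
        (gd i k * gd j l - gd i l * gd j k).
Proof.
pose Om := Spacetime I_interval I_interior (@coord_open R n M c).
pose ga := @metric_fun R n Om (g c) (@metric_smooth _ _ _ _ g c).
have gaP a b : represents (ga a b) (fun s z => g c s z a b) by exact: to_fun_mk.
have [gi [giP gisym giV]] := @metric_inverse R n Om (g c) (@metric_smooth _ _ _ _ g c)
  (@Defs.metric_sym _ _ _ _ g c) (@metric_posdef _ _ _ _ g c).
have gsym a b : ga a b = ga b a.
  apply: smooth_fun_eq => s z Is Vz; rewrite !gaP //.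
  by rewrite -[in RHS](@Defs.metric_sym _ _ _ _ g c s z Is Vz) mxE.
pose half := cst_smooth Om 2^-1.
have halfP : half + half = 1.
  apply: smooth_fun_eq => s z Is Vz; rewrite to_funD // rep_cst //.
  rewrite /to_fun (extendE _ (conj Is Vz)) -[RHS]/(1 : R); lra.
pose xa := cst_smooth Om (n%:R - 2)^-1.
pose ya := cst_smooth Om (n%:R - 1)^-1.
have inv_cst (m : nat) : (m < n)%N -> cst_smooth Om (n%:R - m%:R)^-1 * (n%:R - m%:R) = 1.
  move=> mn; apply: smooth_fun_eq => s z Is Vz; rewrite to_funM // rep_cst //.
  have -> : to_fun (n%:R - m%:R : smooth_fun Om) s z = n%:R - m%:R.
    rewrite /to_fun (extendE _ (conj Is Vz)) -[LHS]/(ev_at _ (n%:R - m%:R)).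
    by rewrite rmorphB !rmorph_nat.
  rewrite mulVf; first by rewrite /to_fun (extendE _ (conj Is Vz)).
  by rewrite subr_eq0 eqr_nat gtn_eqF.
have xaP : xa * (n%:R - 2) = 1 by apply: (inv_cst 2).
have yaP : ya * (n%:R - 1) = 1 by apply: (inv_cst 1 (ltnW hn)).
have flow a b : der (D := Om) None (ga a b)
   = - (ric gi (riemann (fun i => der (D := Om) (Some i)) ga gi half) a b
        + ric gi (riemann (fun i => der (D := Om) (Some i)) ga gi half) a b).
  apply: smooth_fun_eq => s z Is Vz.
  rewrite to_fun_der // (eq_deriv_along _ (gaP a b)) //=.
  rewrite hflow //.
  rewrite (repN (repD (rep_ric gaP giP a b) (rep_ric gaP giP a b)) Is Vz); ring.
have E := weyl_evolution (fun p => @der_derivation R n Om (Some p))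
  (fun p q => @der_comm R n Om (Some p) (Some q)) (@der_derivation R n Om None)
  (fun p => @der_comm R n Om None (Some p)) halfP gsym gisym giV xaP yaP flow i j k l.
have xr : represents xa (fun _ _ => (n%:R - 2)^-1) by exact: rep_cst.
have yr : represents ya (fun _ _ => (n%:R - 1)^-1) by exact: rep_cst.
have r2 := @rep_nat R n Om 2.
have rB := rep_quad gaP giP xr yr.
have rR := rep_ric gaP giP.
have rS := rep_scal gaP giP.
have rI := rep_ric_norm2 gaP giP.
have rP := rep_ric_square gaP giP.
have rL := repB (rep_der None (rep_weyl gaP giP xr yr i j k l))
                (rep_laplacian_weyl gaP giP xr yr i j k l).
have rBs := repB (repD (repB (rB i j k l) (rB i j l k)) (rB i k j l)) (rB i l j k).
have rA := rep_ric_act gaP giP xr yr i j k l.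
have rT1 := repB (repM r2 rBs) rA.
have rx2 := repM xr xr.
have rT2 := repM (repM r2 rx2) (rep_kn i j k l rP gaP).
have rT3 := repM (repM (repM r2 rS) rx2) (rep_kn i j k l rR gaP).
have rT4 := repM (repM r2 xr) (rep_wedge i j k l rR rR).
have rT5 := repM (repM (repM r2 (repB (repM rS rS) rI)) (repM yr rx2))
                 (rep_wedge i j k l gaP gaP).
have rRHS := repD (repD (repB (repD rT1 rT2) rT3) rT4) rT5.
have := congr1 (fun f => to_fun f t x) E; rewrite !expr2.
rewrite (rL t x ht hx) (rRHS t x ht hx) => {}E.
move=> G gd gu Ric S W D N.
apply: (etrans E).
rewrite (kn_square_expand gu Ric gd i j k l) /kn.
have N1 : N - 1 != 0 by rewrite subr_eq0 (eqr_nat R n 1) gtn_eqF // ltnW.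
have N2 : N - 2 != 0 by rewrite subr_eq0 (eqr_nat R n 2) gtn_eqF.
exact: collect_coefficients.
Qed.
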